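(* Let $G$ be a finitely generated non-amenable group acting geometrically on a proper geodesic metric space $(X,d)$ with base point $o\in X$, and let $\mu$ be an irreducible, finitely supported probability measure on $G$ with Green function $\mathcal G$. For any constants $k,\mathfrak s\ge0$ and any Morse gauge $\kappa$, there exists a constant $C=C(\kappa,\mathfrak s,k)>0$ with the following property. Let $Y=Y_1\cup Y_2$ be a $\kappa$-Morse subset of $X$ which is $\mathfrak s$-narrow at a point $zo\in X$, $z\in G$. If $xo,yo\in X$ are $k$-antipodal along $(Y,zo)$ for some elements $x,y\in G$, then $$C^{-1}\mathcal G(x,z)\mathcal G(z,y)\le\mathcal G(x,y)\le C\,\mathcal G(x,z)\mathcal G(z,y).$$
   Context: A geometric action is a proper cocompact isometric action. The group, the action, the base point $o$ and $\mu$ are fixed; constants may depend on them. Irreducible means that for all $x,y\in G$ there is $n$ with $p_n(x,y):=\mu^{*n}(x^{-1}y)>0$. $\mathcal G(x,y)=\sum_{n\ge0}p_n(x,y)$, finite since $G$ is non-amenable. Morse: a Morse gauge is a function $\kappa:[1,\infty)\to[0,\infty)$; $Y\subset X$ is $\kappa$-Morse if every $c$-quasi-geodesic with endpoints on $Y$ lies in the $\kappa(c)$-neighborhood of $Y$, for all $c\ge1$. A $c$-quasi-geodesic is a map $\varphi$ from an interval with $c^{-1}|s-t|-c\le d(\varphi(s),\varphi(t))\le c|s-t|+c$. Narrowness: $Y=Y_1\cup Y_2$ is $\mathfrak s$-narrow at $z\in X$ if $d(y_1,y_2)+\mathfrak s\ge d(y_1,z)+d(z,y_2)$ for all $y_1\in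 Y_1$, $y_2\in Y_2$. $\pi_Y(x)=\{p\in Y:d(x,p)=d(x,Y)\}$ is the nearest-point projection; subsets onto which one projects are closed. Two points $x,y\in X$ are $k$-antipodal along $(Y,z)$ (where $Y=Y_1\cup Y_2$ is narrow at $z$) if $\pi_Y(x)\subset Y_1$, $\pi_Y(y)\subset Y_2$, and $$d(x,Y)\le k\cdot\mathrm{diam}(\pi_Y(x)\cup\{z\}),\qquad d(y,Y)\le k\cdot\mathrm{diam}(\pi_Y(y)\cup\{z\}).$$ *)

(* Defs.v *)
From HB Require Import structures.
From mathcomp Require Import all_boot all_order all_algebra.
From mathcomp Require Import all_classical all_reals all_analysis.

Set Implicit Arguments.
Unset Strict Implicit.
Unset Printing Implicit Defensive.

Import Order.TTheory GRing.Theory Num.Theory.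

Local Open Scope classical_set_scope.
Local Open Scope ring_scope.

Section Groups.
Context (G : groupType).

Definition is_subgroup (H : set G) : Prop :=
  [/\ H 1%g,
      forall g h, H g -> H h -> H (g * h)%g
    & forall g, H g -> H g^-1%g].

Definition finitely_generated : Prop :=
  exists2 S : set G, finite_set S & smallest is_subgroup S = setT.

(* von Neumann: existence of a left-invariant finitely additive probability
   measure defined on all subsets of the discrete group G *)
Definition amenable (R : realType) : Prop :=
  exists m : set G -> R,
    [/\ forall A, 0 <= m A,
        m setT = 1,
        forall A B, A `&` B = set0 -> m (A `|` B) = m A + m B
      & forall g A, m [set (g * h)%g | h in A] = m A].

End Groups.

Section RandomWalk.
Context {R : realType} {G : groupType}.
Implicit Types mu nu : G -> R.

Definition finitely_supported_probability mu : Prop :=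
  [/\ forall g, 0 <= mu g,
      finite_set [set g | mu g != 0]
    & \sum_(g \in [set: G]) mu g = 1].

(* \sum_(h \in _) is the sum over the support; it is 0 by convention when the
   support is infinite, which never happens for a finitely supported mu. *)
Definition convolution mu nu : G -> R :=
  fun g => \sum_(h \in [set: G]) mu h * nu (h^-1 * g)%g.

Definition convolution_power mu (n : nat) : G -> R :=
  iter n (convolution mu) (fun g => (g == 1%g)%:R).

Definition transition mu (n : nat) (x y : G) : R :=
  convolution_power mu n (x^-1 * y)%g.

Definition irreducible mu : Prop :=
  forall x y : G, exists n, 0 < transition mu n x y.

(* The sum of a series of nonnegative terms, hence taken in \bar R. *)
Definition green mu (x y : G) : \bar R :=
  (\sum_(0 <= n <oo) (transition mu n x y)%:E)%E.

End RandomWalk.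

Section MetricSpaces.
Context {R : realType} (X : metricType R).

Definition proper_space : Prop :=
  forall (x : X) (r : R), compact [set y : X | mdist x y <= r].

Definition geodesic_space : Prop :=
  forall x y : X, exists gamma : R -> X,
    [/\ gamma 0 = x,
        gamma (mdist x y) = y
      & {in `[0, mdist x y] &, forall s t,
          mdist (gamma s) (gamma t) = `|s - t| }].

End MetricSpaces.

Section GeometricAction.
Context {R : realType} {G : groupType} {X : metricType R} (act : G -> X -> X).

Definition is_left_action : Prop :=
  (forall p, act 1%g p = p) /\
  (forall g h p, act (g * h)%g p = act g (act h p)).

Definition isometric_action : Prop :=
  forall g p q, mdist (act g p) (act g q) = mdist p q.

Definition proper_action : Prop :=
  forall K : set X, compact K ->
    finite_set [set g | (act g @` K) `&` K !=set0].

Definition cocompact_action : Prop :=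
  exists2 K : set X, compact K & \bigcup_(g in [set: G]) (act g @` K) = setT.

Definition geometric_action : Prop :=
  [/\ is_left_action, isometric_action, proper_action & cocompact_action].

End GeometricAction.

Section Morse.
Context {R : realType} {X : metricType R}.

Definition quasi_geodesic (c : R) (I : interval R) (phi : R -> X) : Prop :=
  {in I &, forall s t,
    c^-1 * `|s - t| - c <= mdist (phi s) (phi t) /\
    mdist (phi s) (phi t) <= c * `|s - t| + c}.

(* A Morse gauge is only constrained, and only used, on [1, +oo[. *)
Definition morse_gauge (kappa : R -> R) : Prop :=
  forall c, 1 <= c -> 0 <= kappa c.

(* The distance to a set is the library's [edist_inf], which takes values in
   \bar R; it is +oo for the empty set.  Neighborhoods are closed. *)
Definition morse (kappa : R -> R) (Y : set X) : Prop :=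
  forall c, 1 <= c ->
  forall (a b : R) (phi : R -> X), a <= b ->
    quasi_geodesic c `[a, b] phi -> Y (phi a) -> Y (phi b) ->
  forall t, t \in `[a, b] -> (edist_inf Y (phi t) <= (kappa c)%:E)%E.

Definition narrow (s : R) (Y1 Y2 : set X) (z : X) : Prop :=
  forall y1 y2, Y1 y1 -> Y2 y2 ->
    mdist y1 z + mdist z y2 <= mdist y1 y2 + s.

Definition projection (Y : set X) (x : X) : set X :=
  [set p | Y p /\ (mdist x p)%:E = edist_inf Y x].

Definition diam (A : set X) : \bar R :=
  ereal_sup [set e | exists p q, [/\ A p, A q & e = (mdist p q)%:E]].

Definition antipodal (k : R) (Y1 Y2 : set X) (z x y : X) : Prop :=
  let Y := Y1 `|` Y2 in
  [/\ projection Y x `<=` Y1,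
      projection Y y `<=` Y2,
      (edist_inf Y x <= k%:E * diam (projection Y x `|` [set z]))%E
    & (edist_inf Y y <= k%:E * diam (projection Y y `|` [set z]))%E].

End Morse.

(* Main.v *)
Require Import Defs.
From mathcomp Require Import all_boot all_order all_algebra.
From mathcomp Require Import all_classical all_reals all_analysis.
From mathcomp Require Import ring lra.

(** The lower bound is the supermultiplicativity of the Green function.  For the
    upper bound, non-amenability gives a spectral gap, hence exponential decay
    of the transition probabilities, so that long paths contribute little.
    Nearest-point projections to a Morse set are sublinearly contracting;
    therefore a path of length O(n) from [x] to [y], where [x] is at distance
    about [n] from [z], has to pass, on the side of [x], through points at
    distance at most n/4 of [z] which are again in position to be antipodal to
    [y].  The maximum principle then bounds G(x,y) / (G(x,z) G(z,y)) at scale n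
    by its supremum at the scale n/2, up to a summable error; the point [y] is
    treated in the same way with the reversed walk. *)

Set Implicit Arguments.
Unset Strict Implicit.
Unset Printing Implicit Defensive.

Import Order.TTheory GRing.Theory Num.Theory.
Import numFieldNormedType.Exports.

Local Open Scope classical_set_scope.
Local Open Scope ring_scope.

(** * Spectral gap *)

(** The constants interlock as follows. At distance n from z the Green function is only known to be
    at least of order c^n, so the discarded paths must be longer than A n, where rho^A is small
    compared with c^2. The paths left to control geometrically have length at most A n, for an A
    that may be large but is fixed before n. This is why sublinear contraction suffices: such a
    path, cut into boundedly many pieces, moves its projection by at most eta n, for any prescribed
    eta > 0 and large n, as long as it stays at distance at least delta n from the Morse set.
    Antipodality is replaced by the condition [cone] on a single point and a single nearest point;
    it is recovered at an intermediate vertex with the same constant [K], and this is what allows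
    the halving of scales to be iterated down to a bounded scale, where Green functions are bounded
    above and below. *)

Lemma convex_sum_sqr_defect (R : realFieldType) (I : eqType) (S : seq I)
    (w b : I -> R) (a : R) (i : I) :
  (forall j, 0 <= w j) -> \sum_(j <- S) w j = 1 -> i \in S ->
  ((a + \sum_(j <- S) w j * b j) / 2) ^+ 2 <=
  (a ^+ 2 + \sum_(j <- S) w j * b j ^+ 2) / 2 - w i / 8 * (a - b i) ^+ 2.
Proof.
move=> w0 w1 iS; set L := \sum_(j <- S) w j * b j.
have LE : \sum_(j <- S) w j * b j = L by [].
clearbody L.
(* With V this variance, the convexity defect is exactly (a - L)^2 / 4 + V / 2; keep only the term i
   of V and use (a - b i)^2 <= 2 (a - L)^2 + 2 (b i - L)^2. *)
have varE : \sum_(j <- S) w j * (b j - L) ^+ 2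
    = \sum_(j <- S) w j * b j ^+ 2 - L ^+ 2.
  transitivity (\sum_(j <- S) w j * b j ^+ 2 -
    2 * L * \sum_(j <- S) w j * b j + L ^+ 2 * \sum_(j <- S) w j).
    rewrite !mulr_sumr -sumrB -big_split/=; apply: eq_bigr => j _; ring.
  by rewrite w1 LE; ring.
have wiL : w i * (b i - L) ^+ 2 <= \sum_(j <- S) w j * (b j - L) ^+ 2.
  rewrite (big_rem i iS)/= lerDl sumr_ge0// => j _.
  by rewrite mulr_ge0// sqr_ge0.
have wi1 : w i <= 1.
  by rewrite -w1 (big_rem i iS)/= lerDl sumr_ge0.
set V := \sum_(j <- S) w j * b j ^+ 2 in varE *.
have wi0 := w0 i.
have := mulr_ge0 wi0 (sqr_ge0 (a + b i - L *+ 2)).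
have : 0 <= (1 - w i) * (a - L) ^+ 2 by rewrite mulr_ge0 ?sqr_ge0// subr_ge0.
move: wiL; rewrite varE; have := mulr_ge0 wi0 (sqr_ge0 (b i - L)); nra.
Qed.

(** * Sums of finitely supported functions on a group *)

Section GroupSum.
Context {R : realType} {G : groupType}.
Implicit Types f g : G -> R.

Definition gsum f : R := \sum_(x \in [set: G]) f x.

Definition finsupp f := finite_set [set x | f x != 0].

Lemma gsum_seq f (r : seq G) :
  uniq r -> (forall x, x \notin r -> f x = 0) -> gsum f = \sum_(x <- r) f x.
Proof.
move=> ur fr; rewrite (bigfs _ ur (P := predT)); last by move=> x _; exact: fr.
by apply: eq_fsbigl; apply/seteqP.
Qed.

Lemma finsuppP f : finsupp f ->
  exists2 r : seq G, uniq r & forall x, x \notin r -> f x = 0.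
Proof.
move=> /finite_seqP[r rE]; exists (undup r); first exact: undup_uniq.
move=> x; rewrite mem_undup => xr; apply/eqP; apply: contraNT xr => fx.
by have : [set` r] x by rewrite -rE.
Qed.

Lemma finsupp_sub f (r : seq G) : (forall x, x \notin r -> f x = 0) -> finsupp f.
Proof.
move=> fr; apply: (@sub_finite_set _ _ [set` r]); last exact: finite_seq.
by move=> x /=; apply: contraNT => /fr ->.
Qed.

Lemma finsupp2 f g : finsupp f -> finsupp g -> exists2 r : seq G, uniq r &
  (forall x, x \notin r -> f x = 0) /\ (forall x, x \notin r -> g x = 0).
Proof.
move=> /finsuppP[r _ fr] /finsuppP[t _ gt]; exists (undup (r ++ t)).
  exact: undup_uniq.
by split=> x; rewrite mem_undup mem_cat negb_or => /andP[? ?]; auto.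
Qed.

Lemma finsuppW f g : finsupp f -> (forall x, f x = 0 -> g x = 0) -> finsupp g.
Proof. by move=> /finsuppP[r _ fr] fg; apply: (@finsupp_sub _ r) => x /fr/fg. Qed.

Lemma finsuppD f g : finsupp f -> finsupp g -> finsupp (fun x => f x + g x).
Proof.
move=> ff fg; have [r _ [fr gr]] := finsupp2 ff fg.
by apply: (@finsupp_sub _ r) => x xr; rewrite fr// gr// addr0.
Qed.

Lemma finsuppZ c f : finsupp f -> finsupp (fun x => c * f x).
Proof. by move=> ff; apply: finsuppW ff _ => x ->; rewrite mulr0. Qed.

Lemma finsuppB f g : finsupp f -> finsupp g -> finsupp (fun x => f x - g x).
Proof.
move=> ff fg; apply: finsuppD => //.
by apply: finsuppW fg _ => x ->; rewrite oppr0.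
Qed.

Lemma finsupp_sum (I : Type) (S : seq I) (F : I -> G -> R) :
  (forall i, finsupp (F i)) -> finsupp (fun x => \sum_(i <- S) F i x).
Proof.
move=> FF; elim: S => [|i S IHS].
  by apply: (@finsupp_sub _ [::]) => x _; rewrite big_nil.
apply: (@finsuppW (fun x => F i x + \sum_(i <- S) F i x)).
  exact: finsuppD.
by move=> x; rewrite big_cons.
Qed.

Lemma finsupp_translate f a : finsupp f -> finsupp (fun x => f (a * x)%g).
Proof.
move=> /finsuppP[r _ fr]; apply: (@finsupp_sub _ (map (fun y => a^-1 * y)%g r)) => x xr.
apply: fr; apply: contra xr => xr; apply/mapP; exists (a * x)%g => //.
by rewrite mulKg.
Qed.

Lemma gsumD f g : finsupp f -> finsupp g ->
  gsum (fun x => f x + g x) = gsum f + gsum g.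
Proof.
move=> ff fg; have [r ur [fr gr]] := finsupp2 ff fg.
rewrite !(@gsum_seq _ r)// ?big_split// => x xr.
by rewrite fr// gr// addr0.
Qed.

Lemma gsumZ c f : finsupp f -> gsum (fun x => c * f x) = c * gsum f.
Proof.
move=> /finsuppP[r ur fr]; rewrite !(@gsum_seq _ r)// ?mulr_sumr// => x xr.
by rewrite fr// mulr0.
Qed.

Lemma gsum_sum (I : Type) (S : seq I) (F : I -> G -> R) :
  (forall i, finsupp (F i)) ->
  gsum (fun x => \sum_(i <- S) F i x) = \sum_(i <- S) gsum (F i).
Proof.
move=> FF; elim: S => [|i S IHS].
  by rewrite big_nil /gsum fsbig1// => x _; rewrite big_nil.
rewrite big_cons -IHS -gsumD//; last exact: finsupp_sum.
by congr gsum; apply/funext => x; rewrite big_cons.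
Qed.

Lemma le_gsum f g : finsupp f -> finsupp g -> (forall x, f x <= g x) ->
  gsum f <= gsum g.
Proof.
move=> ff fg fleg; have [r ur [fr gr]] := finsupp2 ff fg.
by rewrite !(@gsum_seq _ r)// ler_sum.
Qed.

Lemma gsum_ge0 f : (forall x, 0 <= f x) -> 0 <= gsum f.
Proof. by move=> f0; apply: fsumr_ge0. Qed.

Lemma gsum_translate f a : gsum (fun x => f (a * x)%g) = gsum f.
Proof.
rewrite /gsum [RHS](reindex_fsbigT (fun x => a * x)%g)//.
by exists (fun x => a^-1 * x)%g => x; rewrite (mulKg, mulVKg).
Qed.

Lemma le_gsum1 f x : finsupp f -> (forall x, 0 <= f x) -> f x <= gsum f.
Proof.
move=> /finsuppP[r ur fr] f0; rewrite (@gsum_seq _ r)//.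
have [xr|/fr ->] := boolP (x \in r); last by rewrite sumr_ge0.
by rewrite (big_rem x)//= lerDl sumr_ge0.
Qed.

End GroupSum.

(** * Norm contraction of the lazy walk *)

Section SpectralGap.
Context {R : realType} {G : groupType} (mu : G -> R) (S : seq G).
Hypothesis mu_ge0 : forall g, 0 <= mu g.
Hypothesis mu_gt0 : forall s, s \in S -> 0 < mu s.
Hypothesis mu_sum1 : \sum_(s <- S) mu s = 1.
Hypothesis S_generates : forall H : G -> Prop, H 1%g ->
  (forall g s, s \in S -> H g -> H (s * g)%g) -> forall g, H g.

(* Laziness guarantees that a loss of norm detects every difference between
   [f] and a translate of [f]; parity may hide it from [mu] alone. *)
Definition lazy_step (f : G -> R) : G -> R :=
  fun x => (f x + \sum_(s <- S) mu s * f (s^-1 * x)%g) / 2.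

Definition sqnorm (f : G -> R) : R := gsum (fun x => f x ^+ 2).

Lemma finsupp_sqr (f : G -> R) : finsupp f -> finsupp (fun x => f x ^+ 2).
Proof. by move=> ff; apply: finsuppW ff _ => x ->; rewrite expr0n. Qed.

Lemma finsupp_lazy_step (f : G -> R) : finsupp f -> finsupp (lazy_step f).
Proof.
move=> ff; apply: (@finsuppW _ _
    (fun x => f x + \sum_(s <- S) mu s * f (s^-1 * x)%g)); last first.
  by move=> x; rewrite /lazy_step => ->; rewrite mul0r.
apply: finsuppD => //; apply: finsupp_sum => s.
exact/finsuppZ/finsupp_translate.
Qed.

(** Sum the pointwise convexity defect over the group: translation invariance turns every average of
    translated squares into [sqnorm f]. *)
Lemma sqnorm_lazy_step (f : G -> R) (s : G) : finsupp f -> s \in S ->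
  sqnorm (lazy_step f) <=
  sqnorm f - mu s / 8 * sqnorm (fun x => f x - f (s^-1 * x)%g).
Proof.
move=> ff sS.
have fs t : finsupp (fun x => f (t^-1 * x)%g) by exact: finsupp_translate.
have fs2 t := finsupp_sqr (fs t).
have fd : finsupp (fun x => (f x - f (s^-1 * x)%g) ^+ 2).
  by apply: finsupp_sqr; exact: finsuppB.
have fsum : finsupp (fun x => \sum_(t <- S) mu t * f (t^-1 * x)%g ^+ 2).
  by apply: finsupp_sum => t; apply: finsuppZ.
have f2 := finsupp_sqr ff.
have -> : sqnorm f - mu s / 8 * sqnorm (fun x => f x - f (s^-1 * x)%g) =
    gsum (fun x => 2^-1 * (f x ^+ 2 + \sum_(t <- S) mu t * f (t^-1 * x)%g ^+ 2)
                    + (- (mu s / 8)) * (f x - f (s^-1 * x)%g) ^+ 2).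
  rewrite gsumD; [|by apply: finsuppZ; exact: finsuppD|exact: finsuppZ].
  rewrite gsumZ; last exact: finsuppD.
  rewrite gsumZ// gsumD// gsum_sum; last by move=> t; apply: finsuppZ.
  under eq_bigr do rewrite gsumZ// (gsum_translate (fun x => f x ^+ 2)).
  by rewrite -mulr_suml mu_sum1 /sqnorm; lra.
apply: le_gsum; first exact/finsupp_sqr/finsupp_lazy_step.
  by apply: finsuppD; [apply: finsuppZ; exact: finsuppD|exact: finsuppZ].
move=> x; have := convex_sum_sqr_defect (fun t => f (t^-1 * x)%g) (f x)
  mu_ge0 mu_sum1 sS.
by rewrite /lazy_step; lra.
Qed.

(* AM-GM with a free parameter [k] replaces the Cauchy-Schwarz estimate of
   the l^1 norm of [f^2 - (a f)^2]. *)
Lemma sqnorm_restrict_translate (f : G -> R) (A : set G) (a : G) (k : R) :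
  finsupp f -> 0 < k ->
  `|sqnorm (fun x => f x * (x \in [set (a * h)%g | h in A])%:R) -
    sqnorm (fun x => f x * (x \in A)%:R)| <=
  k / 2 * sqnorm (fun x => f x - f (a^-1 * x)%g) + 2 / k * sqnorm f.
Proof.
move=> ff k0; pose fa x := f (a^-1 * x)%g; pose b x : R := (a^-1 * x \in A)%g%:R.
have ffa : finsupp fa by exact: finsupp_translate.
have fd : finsupp (fun x => f x - fa x).
  exact: finsuppB.
have -> : sqnorm (fun x => f x * (x \in [set (a * h)%g | h in A])%:R) =
    gsum (fun x => b x * f x ^+ 2).
  congr gsum; apply/funext => x; rewrite /b.
  have -> : (x \in [set (a * h)%g | h in A]) = (a^-1 * x \in A)%g.
    apply/idP/idP; rewrite !inE; first by move=> [h Ah <-]; rewrite mulKg.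
    by exists (a^-1 * x)%g; rewrite ?mulVKg.
  by rewrite exprMn mulrC; case: (_ \in A); rewrite ?expr1n ?expr0n.
have -> : sqnorm (fun x => f x * (x \in A)%:R) = gsum (fun x => b x * fa x ^+ 2).
  rewrite /sqnorm -(gsum_translate _ a^-1); congr gsum; apply/funext => x.
  by rewrite exprMn mulrC /b /fa; case: (_ \in A); rewrite ?expr1n ?expr0n.
have fb (h : G -> R) : finsupp h -> finsupp (fun x => b x * h x ^+ 2).
  by move=> fh; apply: finsuppW fh _ => x ->; rewrite expr0n mulr0.
have fb' (h : G -> R) : finsupp h -> finsupp (fun x => -1 * (b x * h x ^+ 2)).
  by move=> fh; apply: finsuppZ; exact: fb.
pose e x := k / 2 * (f x - fa x) ^+ 2 + (k^-1 * f x ^+ 2 + k^-1 * fa x ^+ 2).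
have fe : finsupp e.
  by apply: finsuppD; [|apply: finsuppD]; apply: finsuppZ; exact: finsupp_sqr.
have <- : gsum e =
    k / 2 * sqnorm (fun x => f x - f (a^-1 * x)%g) + 2 / k * sqnorm f.
  rewrite gsumD; [|by apply: finsuppZ; exact: finsupp_sqr|
    by apply: finsuppD; apply: finsuppZ; exact: finsupp_sqr].
  rewrite gsumD; [|by apply: finsuppZ; exact: finsupp_sqr..].
  rewrite !gsumZ; [|exact: finsupp_sqr..].
  rewrite (gsum_translate (fun x => f x ^+ 2)) /sqnorm /fa.
  ring.
have b01 x : b x = 0 \/ b x = 1 by rewrite /b; case: (_ \in A); [right|left].
(* Factor u^2 - v^2 as (u - v)(u + v), weight the factors by [k], and bound (u + v)^2 by 2 u^2 + 2
   v^2. *)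
have amgm (u v : R) : u ^+ 2 - v ^+ 2 <=
    k / 2 * (u - v) ^+ 2 + (k^-1 * u ^+ 2 + k^-1 * v ^+ 2).
  have kk : k * k^-1 = 1 by rewrite mulfV// gt_eqF.
  have kV : 0 < k^-1 by rewrite invr_gt0.
  have := mulr_ge0 (ltW kV) (sqr_ge0 (k * (u - v) - (u + v))).
  have := mulr_ge0 (ltW kV) (sqr_ge0 (u - v)).
  have -> : k^-1 * (k * (u - v) - (u + v)) ^+ 2 =
      (k * k^-1) * k * (u - v) ^+ 2 - 2 * (k * k^-1) * (u ^+ 2 - v ^+ 2) +
      k^-1 * (u + v) ^+ 2 by ring.
  rewrite kk; nra.
have e0 x : 0 <= e x.
  have kV : 0 <= k^-1 by rewrite invr_ge0 ltW.
  have k2 : 0 <= k / 2 by rewrite divr_ge0// ltW.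
  by rewrite /e addr_ge0// ?addr_ge0// mulr_ge0// sqr_ge0.
rewrite -[X in _ - X]mul1r -mulNr -gsumZ; last exact: fb.
rewrite -gsumD; [|exact: fb|exact: fb'].
rewrite ler_norml; apply/andP; split.
  rewrite -[leLHS]mulN1r -gsumZ//; apply: le_gsum; [exact: finsuppZ|by apply: finsuppD; [exact: fb|exact: fb']|move=> x].
  have := e0 x; have := amgm (fa x) (f x); rewrite /e.
  by case: (b01 x) => ->; lra.
apply: le_gsum; [by apply: finsuppD; [exact: fb|exact: fb']|exact: fe|move=> x].
have := e0 x; have := amgm (f x) (fa x); rewrite /e.
by case: (b01 x) => ->; lra.
Qed.

(** One ultrafilter finer than [\oo] provides limits for all indices at once, even for a family as
    large as the power set of G, and finite additivity passes to these limits. *)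
Lemma ultrafilter_limits (I : Type) (m : I -> nat -> R) :
  (forall i n, 0 <= m i n <= 1) ->
  exists l : I -> R, exists2 F : set_system nat, ProperFilter F &
    \oo `<=` F /\ forall i, m i @ F --> l i.
Proof.
move=> m01.
have [F [FU ooF]] := @ultraFilterLemma nat \oo _.
have cvgm i : exists l : R, m i @ F --> l.
  have := @segment_compact R 0 1; rewrite compact_ultra => /(_ (m i @ F)).
  have mU : UltraFilter (m i @ F).
    split; first exact: fmap_proper_filter.
    move=> H HP /= FH; apply/seteqP; split=> [A HA|]; last exact: FH.
    have [//|nF] := in_ultra_setVsetC (m i @^-1` A) FU.
    have HC : H (~` A) by apply: FH.
    have := @filterI _ H _ A (~` A) HA HC; rewrite setICr => H0.
    by exfalso; apply: (@filter_not_empty _ H HP); exact: H0.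
  case=> [|l [_ ml]]; last by exists l.
  by apply: (@filterE _ F) => n /=; rewrite in_itv/= m01.
have [l lP] := choice cvgm.
by exists l; exists F => //; exact: ultra_proper.
Qed.

(* Without a gap there are almost invariant vectors [f n], and an ultralimit
   of the probability measures with densities proportional to [f n ^+ 2] is an
   invariant mean. *)
Lemma lazy_step_gap : ~ amenable G R ->
  exists2 rho : R, 0 <= rho < 1 &
    forall f, finsupp f -> sqnorm (lazy_step f) <= rho * sqnorm f.
Proof.
apply: contra_notP => /forall2NP ngap.
have /choice[f fP] (n : nat) : exists f : G -> R, finsupp f /\
    (1 - n.+2%:R^-1) * sqnorm f < sqnorm (lazy_step f).
  have [] := ngap (1 - n.+2%:R^-1).
    by case; rewrite subr_ge0 invf_le1 ?ler1n// ltrBlDr ltrDl invr_gt0 ltr0n.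
  by move=> /existsNP[f /not_implyP[ff /negP]]; rewrite -ltNge; exists f.
have ff n : finsupp (f n) by case: (fP n).
have f_almost n s : s \in S ->
    mu s / 8 * sqnorm (fun x => f n x - f n (s^-1 * x)%g)
    <= n.+2%:R^-1 * sqnorm (f n).
  move=> sS; have [_] := fP n; have := sqnorm_lazy_step (ff n) sS.
  by move: n.+2%:R^-1 => c; rewrite mulrBl mul1r; lra.
have sq_ge0 h : 0 <= sqnorm h by apply: gsum_ge0 => x; exact: sqr_ge0.
have S0 : exists s, s \in S.
  case: S mu_sum1 => [|s S' _]; last by exists s; rewrite mem_head.
  by rewrite big_nil => /eqP; rewrite eq_sym oner_eq0.
have f_gt0 n : 0 < sqnorm (f n).
  rewrite lt_def sq_ge0 andbT; apply/eqP => f0.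
  have [s sS] := S0; have := sqnorm_lazy_step (ff n) sS.
  have [_] := fP n; rewrite f0 mulr0 => h1 h2.
  have := mulr_ge0 (mu_ge0 s) (sq_ge0 (fun x => f n x - f n (s^-1 * x)%g)).
  lra.
pose m (A : set G) n := (sqnorm (f n))^-1 * sqnorm (fun x => f n x * (x \in A)%:R).
have fA (A : set G) n : finsupp (fun x => f n x * (x \in A)%:R).
  by apply: finsuppW (ff n) _ => x ->; rewrite mul0r.
have m01 A n : 0 <= m A n <= 1.
  rewrite mulr_ge0 ?invr_ge0//= ler_pdivrMl// mulr1.
  apply: le_gsum; [exact: finsupp_sqr|exact: finsupp_sqr|move=> x].
  by rewrite exprMn -[leRHS]mulr1 ler_wpM2l ?sqr_ge0//; case: (x \in A); rewrite ?expr1n ?expr0n.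
have [l [F FP [ooF lF]]] := ultrafilter_limits m01.

have mT n : m setT n = 1.
  rewrite /m (_ : (fun x => _) = f n); last by apply/funext => x; rewrite in_setT mulr1.
  by rewrite mulVf// gt_eqF.
have mU A B n : A `&` B = set0 -> m (A `|` B) n = m A n + m B n.
  move=> AB0; rewrite /m -mulrDr /sqnorm -gsumD; [|exact: finsupp_sqr..].
  congr (_ * gsum _); apply/funext => x; rewrite in_setU.
  have [xA|xA] := boolP (x \in A); have [xB|xB] := boolP (x \in B) => /=.
  - suff : set0 x by [].
    by rewrite -AB0; split; apply/set_mem.
  - by rewrite ?mulr1 ?mulr0 ?expr0n/= ?addr0 ?add0r.
  - by rewrite ?mulr1 ?mulr0 ?expr0n/= ?addr0 ?add0r.
  - by rewrite ?mulr1 ?mulr0 ?expr0n/= ?addr0 ?add0r.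
have translate_diff A s n (k : R) : s \in S -> 0 < k ->
    `|m [set (s * h)%g | h in A] n - m A n| <=
    k / 2 * (8 / mu s / n.+2%:R) + 2 / k.
  move=> sS k0; have ms := mu_gt0 sS; have fn0 := f_gt0 n.
  rewrite /m -mulrBr normrM [X in X * _]gtr0_norm ?invr_gt0// ler_pdivrMl//.
  apply: le_trans (sqnorm_restrict_translate A s (ff n) k0) _.
  have := f_almost n s sS; set D := sqnorm _ => h.
  have hD : D <= 8 / mu s / n.+2%:R * sqnorm (f n).
    have -> : D = 8 / mu s * (mu s / 8 * D) by field; rewrite gt_eqF.
    by rewrite -[leRHS]mulrA ler_pM2l ?divr_gt0.
  have k2 : 0 <= k / 2 by rewrite divr_ge0// ltW.
  have := ler_wpM2l k2 hD; move: (8 / mu s / n.+2%:R) k^-1 => c kV; lra.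
exists l; split.
- move=> A; apply: (cvgr_to_ge (lF A)); apply: nearW => n.
  by case/andP: (m01 A n).
- have := lF setT; rewrite (_ : m setT = fun=> 1); last exact/funext.
  by move=> lT; apply: (cvg_unique (@Rhausdorff R) lT); exact: cvg_cst.
- move=> A B AB0; apply: (cvg_unique (@Rhausdorff R) (lF (A `|` B))).
  rewrite (_ : m _ = m A \+ m B); first by apply: cvgD; exact: lF.
  by apply/funext => n; exact: mU.
(* The elements that preserve [l] contain 1 and are stable under left multiplication by [S]. *)
- apply: (@S_generates (fun g => forall A, l [set (g * h)%g | h in A] = l A)).
  + by move=> A; congr l; apply/seteqP; split => [_ [h Ah <-]|h Ah]; [rewrite mul1g|exists h; rewrite ?mul1g].
  + move=> g s sS gP A; rewrite -[RHS]gP.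
    rewrite (_ : [set _ | h in A] = [set (s * h)%g | h in [set (g * h)%g | h in A]]); last first.
      by rewrite image_comp; apply: eq_imagel => h _ /=; rewrite mulgA.
    move: [set _ | h in A] => {gP}A.
    apply/eqP; rewrite -subr_eq0 -normr_le0; apply/ler_addgt0Pl => e e0.
    rewrite addr0.
    have cD : (fun n => `|m [set (s * h)%g | h in A] n - m A n|) @ F -->
        `|l [set (s * h)%g | h in A] - l A| by apply: cvg_norm; exact: cvgB.
    apply: (cvgr_to_le cD); apply: ooF.
    have ms := mu_gt0 sS.
    near=> n.
    (* With k = 4 / e the second term is e / 2, and the first is O(1 / n) for this fixed [k]. *)
    apply: le_trans (translate_diff A s n (4 / e) sS _) _; first by rewrite divr_gt0.
    have -> : 2 / (4 / e) = e / 2 by field; rewrite gt_eqF.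
    rewrite -lerBrDr mulrA ler_pdivrMr ?ltr0n// -ler_pdivrMl; last lra.
    near: n; exists (Num.truncn ((e - e / 2)^-1 * (4 / e / 2 * (8 / mu s)))).+1 => // n /= nN.
    apply: ltW; apply: lt_le_trans (truncnS_gt _) _.
    by rewrite ler_nat ltnW// ltnW.
Unshelve. all: by end_near. Qed.
End SpectralGap.

(** * Green functions *)

Lemma geometric_tail_le (R : realFieldType) (t : R) (m N : nat) :
  0 <= t < 1 -> \sum_(m <= n < N) t ^+ n <= t ^+ m / (1 - t).
Proof.
move=> /andP[t0 t1]; have t1' : 0 < 1 - t by rewrite subr_gt0.
have [Nm|mN] := leqP N m.
  by rewrite big_geq// divr_ge0 ?exprn_ge0// ltW.
suff H k : \sum_(m <= n < m + k) t ^+ n = (t ^+ m - t ^+ (m + k)) / (1 - t).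
  rewrite -(subnKC (ltnW mN)) H ler_pM2r ?invr_gt0// gerBl exprn_ge0//.
elim: k => [|k IHk]; first by rewrite addn0 big_geq// subrr mul0r.
rewrite addnS big_nat_recr ?leq_addr//= IHk exprS.
by field; rewrite gt_eqF.
Qed.

Section Kernel.
Context {R : realType} {V : eqType} {I : Type}.
Variables (S : seq I) (w : I -> R) (a : I -> V -> V) (p : nat -> V -> V -> R).

(** Only the first-step decomposition is recorded, so that the walk, its reversal and its lazy
    version share one potential theory. *)
Record walk_kernel : Prop := WalkKernel {
  walk_weight_ge0 : forall i, 0 <= w i;
  walk0 : forall x y, p 0 x y = (x == y)%:R;
  walkS : forall n x y, p n.+1 x y = \sum_(i <- S) w i * p n (a i x) y }.

Hypothesis pW : walk_kernel.

Lemma walk_ge0 n x y : 0 <= p n x y.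
Proof.
elim: n x => [|n IHn] x; first by rewrite (walk0 pW).
by rewrite (walkS pW) sumr_ge0// => i _; rewrite mulr_ge0// (walk_weight_ge0 pW).
Qed.

Definition partial_potential (r : R) (N : nat) x y := \sum_(0 <= n < N) r ^+ n * p n x y.

(** The limit is meaningful once decay at a rate [rho] with r * rho < 1 is known. The value r = 1
    gives the Green function; some r > 1 is used for the lazy walk. *)
Definition potential (r : R) x y : R := limn (fun N => partial_potential r N x y).

Lemma partial_potential0 r x y : partial_potential r 0 x y = 0.
Proof. by rewrite /partial_potential big_geq. Qed.

Lemma partial_potentialS r N x y : partial_potential r N.+1 x y =
  (x == y)%:R + r * \sum_(i <- S) w i * partial_potential r N (a i x) y.
Proof.
rewrite /partial_potential big_nat_recl//= expr0 mul1r (walk0 pW); congr (_ + _).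
rewrite mulr_sumr.
transitivity (\sum_(0 <= n < N) \sum_(i <- S) r * (w i * (r ^+ n * p n (a i x) y))).
  apply: eq_bigr => n _; rewrite (walkS pW) exprS mulr_sumr.
  by apply: eq_bigr => i _; ring.
by rewrite exchange_big/=; apply: eq_bigr => i _; rewrite -mulr_sumr -mulr_sumr.
Qed.

Section Decay.
Variables (r C rho : R).
Hypothesis r_ge0 : 0 <= r.
Hypothesis rho_ge0 : 0 <= rho.
Hypothesis rrho : r * rho < 1.
Hypothesis decay : forall n x y, p n x y <= C * rho ^+ n.

Let rrho01 : 0 <= r * rho < 1. Proof. by rewrite mulr_ge0. Qed.

Lemma decay_ge0 (x : V) : 0 <= C.
Proof.
by apply: le_trans (walk_ge0 0 x x) _; rewrite (le_trans (decay 0 x x))// expr0 mulr1.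
Qed.

Lemma partial_potential_le N x y : partial_potential r N x y <= C / (1 - r * rho).
Proof.
have C0 := decay_ge0 x.
apply: (@le_trans _ _ (C * \sum_(0 <= n < N) (r * rho) ^+ n)).
  rewrite mulr_sumr; apply: ler_sum => n _.
  by rewrite exprMn mulrCA ler_wpM2l// exprn_ge0.
rewrite ler_wpM2l//; apply: le_trans (geometric_tail_le _ _ rrho01) _.
by rewrite expr0 mul1r.
Qed.

Lemma partial_potential_cvg x y :
  (fun N => partial_potential r N x y) @ \oo --> potential r x y.
Proof.
apply: (@nondecreasing_is_cvgn R (fun N => partial_potential r N x y)).
  apply/nondecreasing_seqP => N; rewrite /partial_potential big_nat_recr//= lerDl.
  by rewrite mulr_ge0 ?exprn_ge0// walk_ge0.
exists (C / (1 - r * rho)) => _ [N _ <-]; exact: partial_potential_le.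
Qed.

Lemma partial_potential_le_potential N x y :
  partial_potential r N x y <= potential r x y.
Proof.
apply: nondecreasing_cvgn_le; last exact/cvgP/partial_potential_cvg.
apply/nondecreasing_seqP => n; rewrite /partial_potential big_nat_recr//= lerDl.
by rewrite mulr_ge0 ?exprn_ge0// walk_ge0.
Qed.

Lemma potential_le_of_partial x y b :
  (forall N, partial_potential r N x y <= b) -> potential r x y <= b.
Proof.
move=> h; apply: limr_le; first exact/cvgP/partial_potential_cvg.
by apply: nearW => N.
Qed.

Lemma potential_ge0 x y : 0 <= potential r x y.
Proof. by have := partial_potential_le_potential 0 x y; rewrite partial_potential0. Qed.

Lemma potentialE x y : potential r x y =
  (x == y)%:R + r * \sum_(i <- S) w i * potential r (a i x) y.
Proof.
have h1 : (fun N => partial_potential r N.+1 x y) @ \oo --> potential r x y.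
  by rewrite (cvg_shiftS (fun N => partial_potential r N x y)); exact: partial_potential_cvg.
apply: (cvg_unique (@Rhausdorff R) h1).
rewrite (_ : (fun N => _) = (fun N => (x == y)%:R +
    r * \sum_(i <- S) w i * partial_potential r N (a i x) y)); last first.
  by apply/funext => N; rewrite partial_potentialS.
apply: cvgD; first exact: cvg_cst.
apply: cvgM; first exact: cvg_cst.
have cvgS i : (fun N => w i * partial_potential r N (a i x) y) @ \oo -->
    w i * potential r (a i x) y.
  by apply: cvgM; [exact: cvg_cst|exact: partial_potential_cvg].
elim: S => [|i T IHT].
  rewrite (_ : (fun N => _) = (fun=> 0)); last by apply/funext => N; rewrite big_nil.
  by rewrite big_nil; exact: cvg_cst.
rewrite (_ : (fun N => _) = (fun N => w i * partial_potential r N (a i x) y +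
    \sum_(i <- T) w i * partial_potential r N (a i x) y)); last first.
  by apply/funext => N; rewrite big_cons.
by rewrite big_cons; apply: cvgD.
Qed.

End Decay.
End Kernel.

(** * Maximum principle for killed walks *)

Section MaximumPrinciple.
Context {R : realType} {V I : eqType}.
Variables (S : seq I) (w : I -> R) (a : I -> V -> V) (p : nat -> V -> V -> R).
Hypothesis pW : walk_kernel S w a p.

Let w_ge0 := walk_weight_ge0 pW.

(** The walk killed on [U], the starting and final vertices included. *)
Fixpoint killed_walk (U : set V) (n : nat) (x y : V) : R :=
  if `[< U x >] then 0 else
  if n is m.+1 then \sum_(i <- S) w i * killed_walk U m (a i x) y
  else (x == y)%:R.

Lemma killed_walk_in (U : set V) n x y : U x -> killed_walk U n x y = 0.
Proof. by move=> Ux; case: n => [|n] /=; rewrite asboolT. Qed.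

Lemma killed_walk_le (U : set V) n x y : killed_walk U n x y <= p n x y.
Proof.
elim: n x => [|n IHn] x /=; case: asboolP => // _; rewrite ?(walk_ge0 pW)//.
  by rewrite (walk0 pW).
by rewrite (walkS pW) ler_sum// => i _; rewrite ler_wpM2l.
Qed.

Lemma killed_walk_path (U : set V) n x y : killed_walk U n x y != 0 ->
  exists g : nat -> V, [/\ g 0%N = x, g n = y,
    forall i, (i <= n)%N -> ~ U (g i) &
    forall i, (i < n)%N -> exists2 s, s \in S & g i.+1 = a s (g i)].
Proof.
elim: n x => [|n IHn] x /=; case: asboolP => [|nUx]; rewrite ?eqxx//.
  have [<- _|_] := eqVneq x y; last by rewrite eqxx.
  by exists (fun=> x); split => // i; rewrite leqn0.
move=> /eqP sn0.
have [s sS /IHn[g [g0 gn gU gS]]] : exists2 s, s \in S &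
    killed_walk U n (a s x) y != 0.
  apply: contra_notP sn0 => /forall2NP h; apply: big1_seq => s /= sS.
  by have [//|/negP] := h s; rewrite negbK => /eqP ->; rewrite mulr0.
exists (fun i => if i is j.+1 then g j else x); split => //.
- by case=> // i; rewrite ltnS; exact: gU.
- by case=> [_|i]; [exists s|rewrite ltnS => /gS].
Qed.

(** Induction on [N]: on [U] the bound is assumed, and off [U] one step is made and superharmonicity
    absorbs the average of [h]. Partial sums replace a decomposition at the hitting time of [U]. *)
Lemma maximum_principle (U : set V) (h : V -> R) (y : V) :
  (forall x, 0 <= h x) ->
  (forall x, \sum_(i <- S) w i * h (a i x) <= h x) ->
  (forall N u, U u -> partial_potential p 1 N u y <= h u) ->
  forall N x, partial_potential p 1 N x y <=
    \sum_(0 <= n < N) killed_walk U n x y + h x.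
Proof.
move=> h0 hS hU; elim=> [|N IHN] x.
  by rewrite partial_potential0 big_geq// add0r.
have [Ux|nUx] := pselect (U x).
  rewrite big1 ?add0r; first exact: hU.
  by move=> n _; rewrite killed_walk_in.
rewrite (partial_potentialS pW) big_nat_recl//=; rewrite !(asboolF nUx) -addrA lerD2l mul1r.

rewrite exchange_big/=.
apply: (@le_trans _ _ (\sum_(i <- S) w i *
    (\sum_(0 <= n < N) killed_walk U n (a i x) y + h (a i x)))).
  by apply: ler_sum => i _; rewrite ler_wpM2l.
rewrite (eq_bigr (fun i => \sum_(0 <= n < N) w i * killed_walk U n (a i x) y
    + w i * h (a i x))); last by move=> i _; rewrite mulrDr mulr_sumr.
by rewrite big_split/= lerD2l.
Qed.

Variables (C rho : R).
Hypothesis rho01 : 0 <= rho < 1.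
Hypothesis decay : forall n x y, p n x y <= C * rho ^+ n.

Let rho_ge0 : 0 <= rho. Proof. by case/andP: rho01. Qed.
Let rho_lt1 : 1 * rho < 1. Proof. by rewrite mul1r; case/andP: rho01. Qed.

Local Notation G := (potential p 1).

Lemma potential1_ge0 x y : 0 <= G x y.
Proof. exact: (potential_ge0 pW ler01 rho_ge0 rho_lt1 decay). Qed.

Lemma partial_le_potential1 N x y : partial_potential p 1 N x y <= G x y.
Proof. exact: (partial_potential_le_potential pW ler01 rho_ge0 rho_lt1 decay). Qed.

Lemma potential1_le x y b : (forall N, partial_potential p 1 N x y <= b) -> G x y <= b.
Proof. exact: (potential_le_of_partial pW ler01 rho_ge0 rho_lt1 decay). Qed.

Lemma potential1E x y : G x y = (x == y)%:R + \sum_(i <- S) w i * G (a i x) y.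
Proof. by rewrite (potentialE pW ler01 rho_ge0 rho_lt1 decay) mul1r. Qed.

Lemma potential1_superharmonic x y : \sum_(i <- S) w i * G (a i x) y <= G x y.
Proof. by rewrite [leRHS]potential1E lerDr. Qed.

Lemma potential1_diag_ge1 x : 1 <= G x x.
Proof.
rewrite potential1E eqxx lerDl sumr_ge0// => i _.
by rewrite mulr_ge0// potential1_ge0.
Qed.

(** Maximum principle for the target z and U = {z}, with [h] the multiple of G(., y) equal to G(z,
    z) at z; a path that ends at z cannot avoid [U]. *)
Lemma potential1_mul_le x z y : G x z * G z y <= G z z * G x y.
Proof.
have Gzz : 0 < G z z by apply: lt_le_trans (potential1_diag_ge1 z).
have [->|Gzy] := eqVneq (G z y) 0.
  by rewrite mulr0 mulr_ge0// ?potential1_ge0// ltW.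
have {}Gzy : 0 < G z y by rewrite lt_def Gzy potential1_ge0.
rewrite -ler_pdivlMr//; apply: potential1_le => N.
pose h v := G z z * G v y / G z y.
have := @maximum_principle [set z] h z.
have h0 v : 0 <= h v by rewrite /h !mulr_ge0 ?invr_ge0 ?potential1_ge0.
have hS v : \sum_(i <- S) w i * h (a i v) <= h v.
  have -> : \sum_(i <- S) w i * h (a i v) =
      G z z / G z y * \sum_(i <- S) w i * G (a i v) y.
    by rewrite mulr_sumr; apply: eq_bigr => i _; rewrite /h; ring.
  rewrite /h [leRHS]mulrAC ler_wpM2l ?potential1_superharmonic//.
  by rewrite divr_ge0 ?ltW.
move=> /(_ h0 hS) H; apply: le_trans (H _ N x) _.
  by move=> M _ ->; rewrite /h -mulrA mulfV ?mulr1 ?gt_eqF// partial_le_potential1.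
rewrite big1 ?add0r// => n _; apply/eqP; apply/negPn/negP.
by move=> /killed_walk_path[g [_ gn gU _]]; apply: (gU n).
Qed.

Lemma potential1_bounded x y : G x y <= C / (1 - rho).
Proof.
apply: potential1_le => N; rewrite -[X in 1 - X]mul1r.
exact: (partial_potential_le pW ler01 rho_ge0 rho_lt1 decay).
Qed.

Lemma killed_walk_tail (U : set V) (L N : nat) x y :
  (forall n, (n <= L)%N -> killed_walk U n x y = 0) ->
  \sum_(0 <= n < N) killed_walk U n x y <= C * (rho ^+ L / (1 - rho)).
Proof.
have C0 : 0 <= C by exact: (decay_ge0 pW decay x).
move=> kL; apply: (@le_trans _ _ (C * \sum_(L <= n < N) rho ^+ n)).
  rewrite mulr_sumr; have [NL|/ltnW LN] := leqP N L.
    by rewrite [leRHS]big_geq// big_nat big1// => n /andP[_ nN]; apply/kL/ltnW/(leq_trans nN).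
  rewrite (@big_cat_nat _ _ _ L)//= [X in X + _]big_nat big1 ?add0r; last first.
    by move=> n /andP[_ /ltnW]; exact: kL.
  by apply: ler_sum => n _; apply: le_trans (killed_walk_le _ _ _ _) (decay _ _ _).
by rewrite ler_wpM2l// geometric_tail_le.
Qed.

End MaximumPrinciple.

(** * Exponential decay of the transition probabilities *)

Section RandomWalk.
Context {R : realType} {G : groupType}.

Record step_distribution (mu : G -> R) (S : seq G) : Prop := StepDistribution {
  step_uniq : uniq S;
  step_gt0 : forall s, s \in S -> 0 < mu s;
  step_notin : forall s, s \notin S -> mu s = 0;
  step_sum : \sum_(s <- S) mu s = 1 }.

Lemma step_distribution_exists (mu : G -> R) :
  finitely_supported_probability mu -> exists S, step_distribution mu S.
Proof.
move=> [mu0 /finsuppP[r ur rP] mu1]; exists [seq x <- r | mu x != 0].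
have notin s : s \notin [seq x <- r | mu x != 0] -> mu s = 0.
  by rewrite mem_filter negb_and negbK => /orP[/eqP//|/rP].
split => //; first exact: filter_uniq.
  by move=> s; rewrite mem_filter => /andP[s0 _]; rewrite lt_def s0 mu0.
by rewrite -mu1 -(gsum_seq _ notin) ?filter_uniq.
Qed.

Variables (mu : G -> R) (S : seq G).
Hypothesis muS : step_distribution mu S.

Let mu_ge0 g : 0 <= mu g.
Proof.
have [/(step_gt0 muS)/ltW//|/(step_notin muS) ->//] := boolP (g \in S).
Qed.

Lemma convolution_seq nu g :
  convolution mu nu g = \sum_(s <- S) mu s * nu (s^-1 * g)%g.
Proof.
rewrite /convolution -[LHS]/(gsum _) (gsum_seq (step_uniq muS))// => s sS.
by rewrite (step_notin muS sS) mul0r.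
Qed.

Lemma transition0 x y : transition mu 0 x y = (x == y)%:R.
Proof.
rewrite /transition /=; congr (nat_of_bool _)%:R; apply/eqP/eqP => [xy|->].
  by rewrite -[y](mulVKg x) xy mulg1.
by rewrite mulVg.
Qed.

Lemma transitionS n x y :
  transition mu n.+1 x y = \sum_(s <- S) mu s * transition mu n (x * s)%g y.
Proof.
rewrite /transition /convolution_power iterS convolution_seq.
by apply: eq_bigr => s _; rewrite invgM mulgA.
Qed.

(** [mu] commutes with its convolution powers; this last-step decomposition makes the reversed walk
    a kernel with steps s^-1. *)
Lemma transitionSr n x y :
  transition mu n.+1 x y = \sum_(s <- S) mu s * transition mu n x (y * s^-1)%g.
Proof.
elim: n x => [|n IHn] x.
  rewrite transitionS; apply: eq_bigr => s _; rewrite !transition0.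
  by congr (_ * (nat_of_bool _)%:R); apply/eqP/eqP => [<-|->]; rewrite ?mulgK ?mulgVK.
rewrite transitionS; under eq_bigr do rewrite IHn mulr_sumr.
rewrite exchange_big/=; apply: eq_bigr => s _.
rewrite transitionS mulr_sumr; apply: eq_bigr => t _; ring.
Qed.

Lemma forward_walk_kernel :
  walk_kernel S mu (fun s x => x * s)%g (transition mu).
Proof. split; [exact: mu_ge0|exact: transition0|exact: transitionS]. Qed.

Lemma backward_walk_kernel :
  walk_kernel S mu (fun s x => x * s^-1)%g (fun n x y => transition mu n y x).
Proof.
split; [exact: mu_ge0| |by move=> n x y; rewrite transitionSr].
by move=> x y; rewrite transition0 eq_sym.
Qed.

Hypothesis mu_irr : irreducible mu.

Lemma support_generates (H : G -> Prop) : H 1%g ->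
  (forall g s, s \in S -> H g -> H (s * g)%g) -> forall g, H g.
Proof.
move=> H1 HS g; have [n] := mu_irr 1%g g; rewrite /transition invg1 mul1g.
move=> /lt0r_neq0; elim: n g => [|n IHn] g /=.
  by have [->//|_] := eqVneq g 1%g; rewrite eqxx.
rewrite convolution_seq => /eqP sn0.
have [s sS /IHn] : exists2 s, s \in S & convolution_power mu n (s^-1 * g)%g != 0.
  apply: contra_notP sn0 => /forall2NP h; apply: big1_seq => s /= sS.
  by have [//|/negP] := h s; rewrite negbK => /eqP ->; rewrite mulr0.
by move=> /(HS _ _ sS); rewrite mulVKg.
Qed.

Definition lazy_power n : G -> R := iter n (lazy_step mu S) (fun g => (g == 1%g)%:R).

Definition lazy_transition n (x y : G) := lazy_power n (x^-1 * y)%g.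

(** [None] is the holding step. *)
Lemma lazy_walk_kernel : walk_kernel (None :: map Some S)
  (fun i => if i is Some s then mu s / 2 else 2^-1)
  (fun i x => if i is Some s then x * s else x)%g lazy_transition.
Proof.
split.
- by case=> [s|]; rewrite ?divr_ge0 ?invr_ge0.
- exact: transition0.
- move=> n x y; rewrite /lazy_transition /lazy_power iterS {1}/lazy_step.
  rewrite big_cons big_map mulrDl mulr_suml mulrC; congr (_ + _).
  by apply: eq_bigr => s _; rewrite invgM mulgA; ring.
Qed.

Lemma lazy_transition_decay : ~ amenable G R ->
  exists2 rho : R, 0 < rho < 1 &
    forall n x y, lazy_transition n x y <= 1 * rho ^+ n.
Proof.
move=> nam; have [rho /andP[rho0 rho1] gap] :=
  (* The contraction bounds squared norms, so the decay rate would be the square root of [rho]; (1 +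
     rho) / 2 dominates it and is positive even when [rho] is 0. *)
  lazy_step_gap mu_ge0 (step_gt0 muS) (step_sum muS) support_generates nam.
pose r := (1 + rho) / 2; have rr : rho <= r ^+ 2.
  by have := sqr_ge0 (1 - rho); rewrite /r; lra.
have r0 : 0 < r by rewrite /r; lra.
exists r; first by rewrite r0 /r; lra.
have fd : finsupp (fun g : G => (g == 1%g)%:R : R).
  apply: (@finsupp_sub _ _ _ [:: 1%g]) => x; rewrite inE => /negbTE ->//.
have fn n : finsupp (lazy_power n).
  by elim: n => [//|n IHn] /=; exact: finsupp_lazy_step.
have normn n : sqnorm (lazy_power n) <= rho ^+ n.
  elim: n => [|n IHn].
    rewrite /sqnorm (@gsum_seq _ _ _ [:: 1%g])//.
      by rewrite big_seq1 /lazy_power/= eqxx expr1n expr0.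
    by move=> x; rewrite inE /lazy_power/= => /negbTE ->; rewrite expr0n.
  rewrite exprS; apply: le_trans (gap _ (fn n)) _.
  by rewrite ler_wpM2l.
move=> n x y; rewrite mul1r leNgt; apply/negP => lt_r.
have rn0 : 0 <= r ^+ n by rewrite exprn_ge0// ltW.
have := le_gsum1 (x^-1 * y)%g (finsupp_sqr (fn n)) (fun g => sqr_ge0 _).
move=> /le_trans/(_ (normn n)); apply/negP; rewrite -ltNge.
apply: (@le_lt_trans _ _ ((r ^+ n) ^+ 2)).
  by rewrite -exprM mulnC exprM lerXn2r// nnegrE ?exprn_ge0// ltW.
by rewrite ltr_pXn2r ?nnegrE// ltW// (le_lt_trans rn0).
Qed.

(* If H is the resolvent of the lazy walk at r in ]1, 2[, then (1 - r/2) H is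
   superharmonic for [mu] with multiplier r / (2 - r) > 1. *)
Lemma transition_decay : ~ amenable G R ->
  exists C, exists2 rho : R, 0 <= rho < 1 &
    forall n x y, transition mu n x y <= C * rho ^+ n.
Proof.
move=> /lazy_transition_decay[rho /andP[rho0 rho1] decay].
(* This makes r * rho = 2 - r, which is less than 1. *)
pose r := 2 / (1 + rho).
have rE : r * (1 + rho) = 2 by rewrite /r mulfVK// gt_eqF// addr_gt0.
have r1 : 1 < r by rewrite /r ltr_pdivlMr; lra.
have r2 : r < 2 by rewrite /r ltr_pdivrMr; lra.
have rrho : r * rho < 1 by lra.
have r0 : 0 <= r by lra.
have HE := potentialE lazy_walk_kernel r0 (ltW rho0) rrho decay.
have HB N x y := partial_potential_le lazy_walk_kernel r0 (ltW rho0) rrho decay N x y.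
have H0 := potential_ge0 lazy_walk_kernel r0 (ltW rho0) rrho decay.
have Hle := potential_le_of_partial lazy_walk_kernel r0 (ltW rho0) rrho decay.
pose H := potential lazy_transition r.
have {}HB x y : H x y <= 1 / (1 - r * rho) by exact: Hle.
have {}HE x y : H x y = (x == y)%:R +
    r / 2 * H x y + r / 2 * \sum_(s <- S) mu s * H (x * s)%g y.
  rewrite {1}/H HE big_cons big_map -/H mulrDr addrA; congr (_ + _ + _).
    by rewrite mulrA.
  by rewrite !mulr_sumr; apply: eq_bigr => s _; rewrite -/H; ring.
(* By the choice of [r], the rate (2 - r) / r is [rho] itself. The bound at time 0 and the induction
   step are both read off the resolvent equation [HE]. *)
exists ((1 - r / 2) * (1 / (1 - r * rho))), ((2 - r) / r).
  by apply/andP; split; [apply: divr_ge0; lra|rewrite ltr_pdivrMr; lra].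
suff key n x y : transition mu n x y <= (1 - r / 2) * H x y * ((2 - r) / r) ^+ n.
  move=> n x y; apply: le_trans (key n x y) _.
  apply: ler_wpM2r; first by apply/exprn_ge0/divr_ge0; lra.
  by apply: ler_wpM2l => //; lra.
elim: n x => [|n IHn] x.
  rewrite transition0 expr0 mulr1.
  have : 0 <= \sum_(s <- S) mu s * H (x * s)%g y.
    by apply: sumr_ge0 => s _; rewrite mulr_ge0 ?H0.
  have := HE x y; have : 0 <= r / 2 by lra.
  move: (_%:R) (\sum_(s <- S) _) => b c r20 Hx c0.
  by have := mulr_ge0 r20 c0; rewrite mulrBl; lra.
rewrite transitionS.
apply: (@le_trans _ _ (\sum_(s <- S) mu s *
    ((1 - r / 2) * H (x * s)%g y * ((2 - r) / r) ^+ n))).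
  by apply: ler_sum => s _; rewrite ler_wpM2l.
rewrite exprS; set t := ((2 - r) / r) ^+ n.
have t0 : 0 <= t by apply/exprn_ge0/divr_ge0; lra.
have -> : \sum_(s <- S) mu s * ((1 - r / 2) * H (x * s)%g y * t) =
    (2 - r) / r * t * (r / 2 * \sum_(s <- S) mu s * H (x * s)%g y).
  rewrite !mulr_sumr; apply: eq_bigr => s _; field; lra.
have -> : r / 2 * \sum_(s <- S) mu s * H (x * s)%g y =
    (1 - r / 2) * H x y - (x == y)%:R.
  by have := HE x y; move: (\sum_(s <- S) _) (_%:R) => u b; lra.
rewrite [leRHS]mulrC; apply: ler_wpM2l; last by rewrite gerBl.
by apply: mulr_ge0 => //; apply: divr_ge0; lra.
Qed.

Lemma green_potential C rho : 0 <= rho < 1 ->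
  (forall n x y, transition mu n x y <= C * rho ^+ n) ->
  forall x y, green mu x y = (potential (transition mu) 1 x y)%:E.
Proof.
move=> /andP[rho0 rho1] decay x y.
have rho1' : 1 * rho < 1 by rewrite mul1r.
have cv : (fun N => partial_potential (transition mu) 1 N x y) @ \oo -->
    potential (transition mu) 1 x y.
  exact: (partial_potential_cvg forward_walk_kernel ler01 rho0 rho1' decay).
rewrite /green (_ : (fun n => _) =
  (fun N => (partial_potential (transition mu) 1 N x y)%:E)); last first.
  apply/funext => N; rewrite sumEFin; congr EFin; apply: eq_bigr => n _.
  by rewrite expr1n mul1r.
by apply/cvg_lim => //; apply: cvg_EFin => //; apply: nearW.
Qed.

End RandomWalk.

(** * Projections to Morse sets *)

(** The error 1 is later absorbed by additive constants of quasi-geodesics. *)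
Lemma near_minimizer (R : realType) (T : Type) (P : set T) (F : T -> R) (m : R) :
  P !=set0 -> (forall x, P x -> m <= F x) ->
  exists2 x, P x & forall y, P y -> F x <= F y + 1.
Proof.
move=> P0 Fm.
have hF : has_inf (F @` P).
  split; first exact: image_nonempty.
  by exists m => _ [x Px <-]; exact: Fm.
have [_ [x Px <-] xinf] := inf_adherent ltr01 hF.
exists x => // y Py; apply/ltW/(lt_le_trans xinf); rewrite lerD2r.
by apply: ge_inf; [case: hF|exists y].
Qed.

Section Nearest.
Context {R : realType} {X : metricType R}.
Implicit Types (Y : set X) (u v p q x y : X).

Lemma edist_mdist x y : edist (x, y) = (mdist x y)%:E.
Proof.
apply/eqP; rewrite eq_le; apply/andP; split.
  apply/lee_addgt0Pr => e e0; rewrite -EFinD; apply: edist_fin => /=.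
    by rewrite ltr_wpDl// mdist_ge0.
  by rewrite ballEmdist/= ltrDl.
apply: le_ereal_inf_tmp => _ [r [r0 xr] <-].
by move: xr; rewrite ballEmdist lee_fin => /ltW.
Qed.

Lemma edist_inf_ge (Y : set X) x (r : R) :
  (forall y, Y y -> r <= mdist x y) -> (r%:E <= edist_inf Y x)%E.
Proof.
by move=> h; apply: le_ereal_inf_tmp => _ [y Yy <-]; rewrite edist_mdist lee_fin h.
Qed.

Lemma edist_inf_le Y x y : Y y -> (edist_inf Y x <= (mdist x y)%:E)%E.
Proof. by move=> Yy; rewrite -edist_mdist; apply: ereal_inf_lbound; exists y. Qed.

Definition nearest Y u p := Y p /\ forall y, Y y -> mdist u p <= mdist u y.

Lemma edist_inf_nearest Y u p : nearest Y u p -> edist_inf Y u = (mdist u p)%:E.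
Proof.
move=> [Yp up]; apply/eqP; rewrite eq_le edist_inf_le//=.
exact: edist_inf_ge.
Qed.

Lemma projectionP Y u p : projection Y u p <-> nearest Y u p.
Proof.
split=> [[Yp upE]|up]; last by split; [case: up|rewrite (edist_inf_nearest up)].
by split => // y Yy; rewrite -lee_fin upE edist_inf_le.
Qed.

Lemma mdist_continuous (x : X) : continuous (mdist x : X -> R).
Proof.
move=> y; apply/cvgrPdist_lt => e e0; near=> z.
have yz : mdist y z < e.
  near: z; have := nbhsx_ballx y e e0; rewrite ballEmdist.
  by apply: filterS.
rewrite ltr_norml.
have := metric_triangle x y z; have := metric_triangle x z y.
by rewrite (metric_sym z y); move: yz; lra.
Unshelve. all: by end_near. Qed.

Lemma nearest_exists Y u : proper_space X -> closed Y -> Y !=set0 ->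
  exists p, nearest Y u p.
Proof.
move=> Xp Yc [y0 Yy0].
pose K := [set y | mdist u y <= mdist u y0] `&` Y.
have [] := @compact_EVT_min X R (mdist u) K.
- by exists y0; split => //=.
- apply: (subclosed_compact _ (Xp u (mdist u y0))); last by move=> y [].
  by apply: closedI => //; apply: compact_closed; [exact: metric_hausdorff|exact: Xp].
- exact/continuous_subspaceT/mdist_continuous.
move=> p; rewrite inE => -[/= up Yp] pmin; exists p; split => // y Yy.
have [yy0|/ltW yy0] := leP (mdist u y) (mdist u y0).
  by apply: pmin; rewrite inE.
exact: le_trans up yy0.
Qed.

Definition unit_speed (g : R -> X) (t : R) :=
  forall a b, 0 <= a <= b -> b <= t -> mdist (g a) (g b) = b - a.

Lemma unit_speedW g t t' : t' <= t -> unit_speed g t -> unit_speed g t'.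
Proof. by move=> tt gt a b ab bt; apply: gt => //; exact: le_trans tt. Qed.

Lemma geodesic_unit_speed p u : geodesic_space X ->
  exists g, [/\ g 0 = p, g (mdist p u) = u & unit_speed g (mdist p u)].
Proof.
move=> /(_ p u)[g [g0 g1 gE]]; exists g; split => // a b /andP[a0 ab] bt.
rewrite gE ?in_itv/= ?a0 ?bt ?andbT; first by rewrite distrC ger0_norm// subr_ge0.
  exact: le_trans bt.
exact: le_trans ab.
Qed.

(** A point of Y closer to [g t] than p would also be closer to u, through [g t]. *)
Lemma nearest_geodesic Y p u g t : nearest Y u p -> g 0 = p ->
  g (mdist p u) = u -> unit_speed g (mdist p u) -> 0 <= t <= mdist p u ->
  nearest Y (g t) p /\ mdist (g t) p = t.
Proof.
move=> [Yp up] g0 g1 gE /andP[t0 tl].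
have tE : mdist (g t) p = t by rewrite metric_sym -g0 gE ?lexx// subr0.
split => //; split => // y Yy; rewrite tE.
have ut : mdist u (g t) = mdist p u - t.
  by rewrite metric_sym -[u in LHS]g1 gE ?t0.
have := up y Yy; have := metric_triangle u (g t) y.
by rewrite ut (metric_sym u p); lra.
Qed.

End Nearest.

(** * Sublinear contraction of nearest-point projections *)

Section MorseProjection.
Context {R : realType} {X : metricType R}.
Hypothesis X_geodesic : geodesic_space X.
Implicit Types (Y : set X) (u v p q : X).

(* The hypotheses make the broken geodesic from [g1 0] through [g1 t1] and
   [g2 t2] to [g2 0] a [c]-quasi-geodesic. *)
Lemma morse_shortcut (kappa : R -> R) Y (g1 g2 : R -> X) (t1 t2 c : R) :
  morse kappa Y -> 7 <= c -> 0 <= t1 -> 0 <= t2 ->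
  unit_speed g1 t1 -> unit_speed g2 t2 -> Y (g1 0) -> Y (g2 0) ->
  (forall a b, 0 <= a <= t1 -> 0 <= b <= t2 ->
    mdist (g1 t1) (g2 t2) - ((t1 - a) + (t2 - b)) / 2 - 1 <=
    mdist (g1 a) (g2 b)) ->
  (forall a b, 0 <= a <= t1 -> 0 <= b <= t2 ->
    (t1 - a) + mdist (g1 t1) (g2 t2) + (t2 - b) <=
    c * (mdist (g1 a) (g2 b) + c)) ->
  (edist_inf Y (g1 t1) <= (kappa c)%:E)%E /\
  (edist_inf Y (g2 t2) <= (kappa c)%:E)%E.
Proof.
move=> Ymorse c7 t10 t20 g1E g2E Y1 Y2.
set l := mdist (g1 t1) (g2 t2) => sep long.
have l0 : 0 <= l by exact: mdist_ge0.
have [h [h0 hl hE]] := geodesic_unit_speed (g1 t1) (g2 t2) X_geodesic.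
rewrite -/l in hl hE.
pose phi t := if t <= t1 then g1 t else if t <= t1 + l then h (t - t1)
              else g2 (t2 - (t - t1 - l)).
have phi1 t : t <= t1 -> phi t = g1 t by rewrite /phi => ->.
have phi2 t : t1 <= t -> t <= t1 + l -> phi t = h (t - t1).
  rewrite /phi => tt ->; case: ifPn => // tt'.
  have -> : t = t1 by apply/eqP; rewrite eq_le tt tt'.
  by rewrite subrr h0.
have phi3 t : t1 + l <= t -> phi t = g2 (t2 - (t - t1 - l)).
  move=> tt; rewrite /phi; case: ifPn => [t_le|_].
    have l00 : l = 0 by lra.
    have -> : t = t1 by lra.
    by rewrite l00 !subrr !subr0; apply/mdist_positivity; exact: l00.
  case: ifPn => // tt'; have -> : t = t1 + l by lra.
  by rewrite addrAC subrr add0r hl subrr subr0.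
have phi_le s t : 0 <= s -> s <= t -> t <= t1 + l + t2 ->
    mdist (phi s) (phi t) <= t - s /\
    t - s <= c * (mdist (phi s) (phi t) + c).
  (* Origin of 7 and 4: take points on [g1] and [h] at distances a and b from their common corner,
     and at distance d from each other. Then [sep] gives b <= d + a / 2 + 1 and the triangle
     inequality a <= d + b, so a + b <= 7 d + 4. Pairs on [g1] and [g2] are handled by [long]. *)
  have cM x y : y - 4 <= 7 * x -> 0 <= x -> y <= c * (x + c).
    move=> yx x0; have : 0 <= (c - 7) * x by rewrite mulr_ge0// subr_ge0.
    have : 0 <= (c - 7) * (c + 7) by rewrite mulr_ge0//; lra.
    lra.
  have d1 a : 0 <= a <= t1 -> mdist (g1 a) (g1 t1) = t1 - a by move=> ?; exact: g1E.
  have d2 b : 0 <= b <= t2 -> mdist (g2 b) (g2 t2) = t2 - b by move=> ?; exact: g2E.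
  have e1 b : 0 <= b <= l -> mdist (g1 t1) (h b) = b.
    by case/andP=> b0 bl; rewrite -h0 hE ?lexx// subr0.
  have e2 b : 0 <= b <= l -> mdist (h b) (g2 t2) = l - b.
    by move=> bl; rewrite -hl hE.
  move=> s0 st tT; have [t_t1|/ltW t1_t] := leP t t1.
    rewrite !phi1//; last exact: le_trans st t_t1.
    rewrite g1E ?s0//; split => //; apply: cM; lra.
  have [s_t1|/ltW t1_s] := leP s t1.
    rewrite (phi1 s)//; have s1 : 0 <= s <= t1 by rewrite s0.
    have [t_l|/ltW l_t] := leP t (t1 + l).
      rewrite phi2//; have tl : 0 <= t - t1 <= l by lra.
      have D1 := d1 s s1; have E1 := e1 _ tl; have E2 := e2 _ tl.
      have t2t2 : 0 <= t2 <= t2 by rewrite t20 lexx.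
      have := sep s t2 s1 t2t2.
      have := metric_triangle (g1 s) (g1 t1) (h (t - t1)).
      have := metric_triangle (g1 s) (h (t - t1)) (g2 t2).
      have := metric_triangle (g1 s) (h (t - t1)) (g1 t1).
      rewrite (metric_sym (h _) (g1 _)) => T1 T2 T3 T4.
      by split; [lra|apply: cM; [lra|exact: mdist_ge0]].
    rewrite phi3//; set b := t2 - _; have b2 : 0 <= b <= t2 by rewrite /b; lra.
    have D1 := d1 s s1; have D2 := d2 b b2.
    have := metric_triangle (g1 s) (g1 t1) (g2 b).
    have := metric_triangle (g1 t1) (g2 t2) (g2 b).
    rewrite (metric_sym (g2 t2)) -/l D1 D2 => T1 T2.
    have := long s b s1 b2; have bE : t2 - b = t - t1 - l by rewrite /b; ring.
    by rewrite bE in T1 * => T3; split; lra.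
  have [s_l|/ltW l_s] := leP s (t1 + l).
    rewrite (phi2 s)//; have sl : 0 <= s - t1 <= l by lra.
    have E1 := e1 _ sl; have E2 := e2 _ sl.
    have [t_l|/ltW l_t] := leP t (t1 + l).
      rewrite phi2// hE; [|lra..]; split; first by lra.
      by apply: cM; lra.
    rewrite phi3//; set b := t2 - _; have b2 : 0 <= b <= t2 by rewrite /b; lra.
    have D2 := d2 b b2; have bE : t2 - b = t - t1 - l by rewrite /b; ring.
    have t1t1 : 0 <= t1 <= t1 by rewrite t10 lexx.
    have := sep t1 b t1t1 b2; have := long t1 b t1t1 b2.
    have := metric_triangle (h (s - t1)) (g2 t2) (g2 b).
    have := metric_triangle (g1 t1) (h (s - t1)) (g2 b).
    have := metric_triangle (g2 b) (h (s - t1)) (g2 t2).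
    rewrite (metric_sym (g2 b) (h _)) (metric_sym (g2 t2)) E1 E2 D2 bE => T1 T2 T3 T4 T5.
    by split; [lra|apply: cM; [lra|exact: mdist_ge0]].
  rewrite !phi3//; last exact: le_trans l_s st.
  by rewrite metric_sym g2E; [|lra..]; split; [lra|apply: cM; lra].
have phiQ : quasi_geodesic c `[0, t1 + l + t2] phi.
  have c0 : 0 < c by lra.
  have H s t : 0 <= s -> s <= t -> t <= t1 + l + t2 ->
      c^-1 * `|s - t| - c <= mdist (phi s) (phi t) /\
      mdist (phi s) (phi t) <= c * `|s - t| + c.
    move=> s0 st tT; have [up low] := phi_le s t s0 st tT.
    rewrite distrC ger0_norm ?subr_ge0//; split.
      by rewrite lerBlDr ler_pdivrMl.
    have : 0 <= (c - 1) * (t - s) by apply: mulr_ge0; lra.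
    by lra.
  move=> s t; rewrite !in_itv/= => /andP[s0 sT] /andP[t0 tT].
  have [st|/ltW ts] := leP s t; first exact: H.
  by rewrite distrC metric_sym; apply: H.
have T0 : 0 <= t1 + l + t2 by rewrite !addr_ge0.
have phiT : phi (t1 + l + t2) = g2 0.
  by rewrite phi3; [congr g2; ring|rewrite lerDl].
have c1 : 1 <= c by lra.
have in_nbhd := Ymorse c c1 0 (t1 + l + t2) phi T0 phiQ.
rewrite phiT phi1// in in_nbhd; have {}in_nbhd := in_nbhd Y1 Y2.
split.
  by rewrite -[g1 t1]phi1//; apply: in_nbhd; rewrite in_itv/=; lra.
have -> : g2 t2 = phi (t1 + l).
  by rewrite phi3//; congr g2; ring.
by apply: in_nbhd; rewrite in_itv/=; lra.
Qed.

(* Near-minimize d(a, b) + theta (d(a, p) + d(b, q)) over a in [p, u] and b in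
   [q, v]: the path p, a, b, q is a quasi-geodesic whose constant depends on
   theta only, so that a and b are close to p and q. *)
Lemma nearest_mdist_le (kappa : R -> R) (theta : R) :
  morse_gauge kappa -> 0 < theta <= 1 ->
  exists2 C : R, 0 <= C & forall Y u v p q, morse kappa Y ->
    nearest Y u p -> nearest Y v q ->
    mdist p q <= mdist u v + theta * (mdist u p + mdist v q) + C.
Proof.
move=> gauge /andP[th0 th1]; pose c := 7 / theta.
have thc : theta * c = 7 by rewrite /c mulrC divfK// gt_eqF.
have c7 : 7 <= c by rewrite /c ler_pdivlMr//; lra.
have k0 : 0 <= kappa c by apply: gauge; lra.
(* The term 2 * kappa c pays for the distances of the near-minimizing points to p and q, and 1 for
   near-minimality. *)
exists (2 * kappa c + 1); first by lra.
move=> Y u v p q Ymorse up vq.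
have [g1 [g10 g1u g1E]] := geodesic_unit_speed p u X_geodesic.
have [g2 [g20 g2v g2E]] := geodesic_unit_speed q v X_geodesic.
have pu0 := mdist_ge0 p u; have qv0 := mdist_ge0 q v.
pose P := [set ab : R * R | 0 <= ab.1 <= mdist p u /\ 0 <= ab.2 <= mdist q v].
pose F (ab : R * R) := mdist (g1 ab.1) (g2 ab.2) + theta * (ab.1 + ab.2).
have [[a b] [/= aP bP] abmin] : exists2 ab, P ab & forall ab', P ab' -> F ab <= F ab' + 1.
  apply: (@near_minimizer _ _ P F 0).
    by exists (0, 0); split => /=; rewrite lexx.
  move=> [a b] [/= /andP[a0 _] /andP[b0 _]]; rewrite /F/= addr_ge0 ?mdist_ge0//.
  by rewrite mulr_ge0 ?addr_ge0// ltW.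
have [a0 a1] := andP aP; have [b0 b1] := andP bP.
set l := mdist (g1 a) (g2 b).
have l0 : 0 <= l := mdist_ge0 _ _.
have lmin a' b' : 0 <= a' <= a -> 0 <= b' <= b ->
    l + theta * ((a - a') + (b - b')) - 1 <= mdist (g1 a') (g2 b').
  move=> /andP[a'0 a'a] /andP[b'0 b'b].
  have := abmin (a', b'); rewrite /F/= -/l.
  have P' : P (a', b') by split => /=; lra.
  by move=> /(_ P'); lra.
have [||||aY bY] := @morse_shortcut kappa Y g1 g2 a b c Ymorse c7 a0 b0
  (unit_speedW a1 g1E) (unit_speedW b1 g2E).
- by rewrite g10; case: up.
- by rewrite g20; case: vq.
- move=> a' b' a'P b'P; have := lmin a' b' a'P b'P; rewrite -/l.
  have := mulr_ge0 (ltW th0) (_ : 0 <= (a - a') + (b - b')); lra.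
- move=> a' b' a'P b'P; have := lmin a' b' a'P b'P; rewrite -/l.
  set e := mdist _ _ => le; have e0 : 0 <= e := mdist_ge0 _ _.
  have c0 : 0 < c by lra.
  set y := a - a' + (b - b') in le; have -> : a - a' + l + (b - b') = l + y by rewrite /y; ring.
  have : c * (theta * (l + y)) <= c * (e + 1).
    by rewrite ler_pM2l//; have := mulr_ge0 (_ : 0 <= 1 - theta) l0; lra.
  rewrite (_ : c * (theta * (l + y)) = theta * c * (l + y)); last by ring.
  rewrite thc; have : 0 <= l + y by rewrite /y; lra.
  have : 0 <= (c - 1) * c by apply: mulr_ge0; lra.
  lra.
have [pu puE] := nearest_geodesic up g10 g1u g1E aP.
have [qv qvE] := nearest_geodesic vq g20 g2v g2E bP.
have ak : a <= kappa c by rewrite -lee_fin -puE -(edist_inf_nearest pu).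
have bk : b <= kappa c by rewrite -lee_fin -qvE -(edist_inf_nearest qv).
have := abmin (mdist p u, mdist q v); rewrite /F/= -/l g1u g2v.
have P' : P (mdist p u, mdist q v) by split => /=; rewrite lexx ?mdist_ge0.
move=> /(_ P'); have := mulr_ge0 (ltW th0) (_ : 0 <= a + b).
have := metric_triangle p (g1 a) (g2 b); have := metric_triangle p (g2 b) q.
rewrite (metric_sym p (g1 a)) puE qvE -/l (metric_sym u p) (metric_sym v q); lra.
Qed.

(* Near-minimize d(a, b) - (d(a, p) + d(b, q)) / 2 instead.  If p and q were far
   apart, the lower bound on d(a, b) given by [nearest_mdist_le] would make the
   path p, a, b, q a quasi-geodesic, which forces a and b close to p and q; but
   then (u, v) has a much smaller value than (a, b). *)
Lemma nearest_contract (kappa : R -> R) (delta A eta : R) :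
  morse_gauge kappa -> 0 < delta -> 0 < A -> 0 < eta ->
  exists n0 : R, forall n, n0 <= n -> forall Y u v p q, morse kappa Y ->
    nearest Y u p -> nearest Y v q ->
    delta * n <= mdist u p <= A * n -> delta * n <= mdist v q <= A * n ->
    mdist u v <= delta * n / 4 -> mdist p q <= eta * n.
Proof.
(* This makes theta * (2 A n) <= eta n / 4; with C <= eta n / 4, a violation d(p, q) > eta n forces
   d(a, b) >= eta n / 2 ([far]). *)
move=> gauge d0 A0 e0; pose theta := eta / (8 * (A + eta)).
have Ae : 0 < 8 * (A + eta) by lra.
have thE : theta * (8 * (A + eta)) = eta by rewrite /theta divfK// gt_eqF.
have th0 : 0 < theta by rewrite divr_gt0.
have th01 : 0 < theta <= 1.
  by rewrite th0/= /theta ler_pdivrMr//; lra.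
have [C C0 lip] := nearest_mdist_le gauge th01.
(* The broken path has length at most (2 A + delta / 4) n, which (c - 7) eta n / 2 dominates. *)
pose c := 7 + (4 * A + delta) / eta.
have ce : (c - 7) * eta = 4 * A + delta by rewrite /c; field; rewrite gt_eqF.
have c7 : 7 <= c by rewrite lerDl divr_ge0//; lra.
have k0 : 0 <= kappa c by apply: gauge; lra.
exists (4 * C / eta + 2 * (kappa c + 1) / delta + 1).
move=> n n0n Y u v p q Ymorse up vq /andP[u1 u2] /andP[v1 v2] uv.
have n1 : 1 <= n.
  have : 0 <= 4 * C / eta by rewrite divr_ge0//; lra.
  have : 0 <= 2 * (kappa c + 1) / delta by rewrite divr_ge0//; lra.
  by move: (4 * C / eta) (2 * (kappa c + 1) / delta) n0n => ? ?; lra.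
have nC : 4 * C <= eta * n.
  rewrite -ler_pdivrMl// mulrC; apply: le_trans n0n.
  have : 0 <= 2 * (kappa c + 1) / delta by rewrite divr_ge0//; lra.
  by move: (4 * C / eta) (2 * (kappa c + 1) / delta) => ? ?; lra.
have nk : 2 * (kappa c + 1) < delta * n.
  rewrite -ltr_pdivrMl// mulrC; apply: lt_le_trans n0n.
  have : 0 <= 4 * C / eta by rewrite divr_ge0//; lra.
  by move: (4 * C / eta) (2 * (kappa c + 1) / delta) => ? ?; lra.
rewrite leNgt; apply/negP => pq.
have [g1 [g10 g1u g1E]] := geodesic_unit_speed p u X_geodesic.
have [g2 [g20 g2v g2E]] := geodesic_unit_speed q v X_geodesic.
have pu0 := mdist_ge0 p u; have qv0 := mdist_ge0 q v.
have puS := metric_sym p u; have qvS := metric_sym q v.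
have far a b : 0 <= a <= mdist p u -> 0 <= b <= mdist q v ->
    eta * n / 2 <= mdist (g1 a) (g2 b).
  move=> aP bP; have [pu puE] := nearest_geodesic up g10 g1u g1E aP.
  have [qv qvE] := nearest_geodesic vq g20 g2v g2E bP.
  have := lip Y _ _ _ _ Ymorse pu qv; rewrite puE qvE.
  have : theta * (a + b) <= eta * n / 4.
    have : theta * (a + b) <= theta * (2 * (A * n)) by rewrite ler_pM2l//; lra.
    have : theta * (8 * A * n) <= eta * n.
      have : theta * (8 * (A + eta)) * n = eta * n by rewrite thE.
      have : 0 <= theta * eta * n by apply: mulr_ge0; [apply/ltW/mulr_gt0|lra].
      lra.
    lra.
  lra.
pose P := [set ab : R * R | 0 <= ab.1 <= mdist p u /\ 0 <= ab.2 <= mdist q v].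
pose F (ab : R * R) := mdist (g1 ab.1) (g2 ab.2) - (ab.1 + ab.2) / 2.
have [[a b] [/= aP bP] abmin] : exists2 ab, P ab & forall ab', P ab' -> F ab <= F ab' + 1.
  apply: (@near_minimizer _ _ P F (- (mdist p u + mdist q v) / 2)).
    by exists (0, 0); split => /=; rewrite lexx.
  move=> [a b] [/= aP bP]; rewrite /F/=; have := mdist_ge0 (g1 a) (g2 b); lra.
have [a0 a1] := andP aP; have [b0 b1] := andP bP.
set l := mdist (g1 a) (g2 b).
have l0 : 0 <= l := mdist_ge0 _ _.
have lle : l <= (mdist p u - a) + (mdist q v - b) + mdist u v.
  have := metric_triangle (g1 a) u (g2 b); have := metric_triangle u v (g2 b).
  have -> : mdist (g1 a) u = mdist p u - a by rewrite -[u in LHS]g1u g1E ?a0.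
  have -> : mdist v (g2 b) = mdist q v - b.
    by rewrite metric_sym -[v in LHS]g2v g2E ?b0.
  by rewrite -/l; lra.
have [||||aY bY] := @morse_shortcut kappa Y g1 g2 a b c Ymorse c7 a0 b0
  (unit_speedW a1 g1E) (unit_speedW b1 g2E).
- by rewrite g10; case: up.
- by rewrite g20; case: vq.
- move=> a' b' a'P b'P; have P' : P (a', b') by split => /=; lra.
  by have := abmin _ P'; rewrite /F/= -/l; lra.
- move=> a' b' a'P b'P; rewrite -/l.
  have far' : eta * n / 2 <= mdist (g1 a') (g2 b') by apply: far; lra.
  have := ler_wpM2l (_ : 0 <= c - 7) far'.
  have -> : (c - 7) * (eta * n / 2) = (c - 7) * eta * n / 2 by ring.
  rewrite ce; have := mulr_ge0 (_ : 0 <= A) (_ : 0 <= n).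
  have := mdist_ge0 (g1 a') (g2 b'); have : 0 <= c * c by apply: mulr_ge0; lra.
  lra.
have [pu puE] := nearest_geodesic up g10 g1u g1E aP.
have [qv qvE] := nearest_geodesic vq g20 g2v g2E bP.
have ak : a <= kappa c by rewrite -lee_fin -puE -(edist_inf_nearest pu).
have bk : b <= kappa c by rewrite -lee_fin -qvE -(edist_inf_nearest qv).
(* The value at (u, v) is at most delta n / 4 - delta n, whereas the near-minimum is at least -
   kappa c; this contradicts [nk]. *)
have P' : P (mdist p u, mdist q v) by split => /=; rewrite lexx ?mdist_ge0.
have := abmin _ P'; rewrite /F/= -/l g1u g2v; lra.
Qed.

End MorseProjection.

(** * Paths crossing a narrow Morse set *)

Lemma last_occurrence (P : nat -> Prop) (m : nat) :
  (forall i, (i <= m)%N -> ~ P i) \/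
  exists j, [/\ (j <= m)%N, P j & forall i, (j < i <= m)%N -> ~ P i].
Proof.
elim: m => [|m IHm].
  have [P0|nP0] := pselect (P 0%N); last by left=> i; rewrite leqn0 => /eqP ->.
  by right; exists 0%N; split => // -[].
have [Pm|nPm] := pselect (P m.+1).
  by right; exists m.+1; split => // i /andP[]; rewrite ltnNge => /negbTE ->.
case: IHm => [nP|[j [jm Pj nP]]]; [left=> i|right; exists j; split=> //].
- by rewrite leq_eqVlt => /orP[/eqP ->//|]; exact: nP.
- exact: leqW.
- move=> i /andP[ji]; rewrite leq_eqVlt => /orP[/eqP ->//|im].
  by apply: nP; rewrite ji.
Qed.

(** [Y1] and [Y2] may overlap; the conclusion keeps the whole initial segment in [Y1]. *)
Lemma first_switch (T : Type) (P : nat -> T) (Y1 Y2 : set T) (N : nat) :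
  Y1 (P 0%N) -> Y2 (P N.+1) -> (forall i, (i <= N)%N -> (Y1 `|` Y2) (P i)) ->
  exists m, [/\ (m <= N)%N, forall i, (i <= m)%N -> Y1 (P i) & Y2 (P m.+1)].
Proof.
move=> P0 PN PY.
suff: (forall i, (i <= N)%N -> Y1 (P i)) \/
    exists m, [/\ (m < N)%N, forall i, (i <= m)%N -> Y1 (P i) & Y2 (P m.+1)].
  by case=> [Y1P|[m [mN Y1P Y2P]]]; [exists N|exists m; split=> //; exact: ltnW].
elim: N {PN} PY => [|N IHN] PY; first by left=> i; rewrite leqn0 => /eqP ->.
case: IHN => [i iN|Y1P|[m [mN Y1P Y2P]]]; first by apply: PY; exact: leqW.
  have [Y1N|Y2N] := PY N.+1 (leqnn _); last by right; exists N.
  by left=> i; rewrite leq_eqVlt => /orP[/eqP ->//|]; exact: Y1P.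
by right; exists m; split => //; exact: leqW.
Qed.

Section Crossing.
Context {R : realType} {X : metricType R}.
Hypothesis X_geodesic : geodesic_space X.
Hypothesis X_proper : proper_space X.
Implicit Types (Y : set X) (u v p q : X) (g : nat -> X) (kappa : R -> R).

Lemma path_mdist_le g (m : nat) (D : R) :
  (forall i, (i < m)%N -> mdist (g i) (g i.+1) <= D) ->
  mdist (g 0%N) (g m) <= m%:R * D.
Proof.
elim: m => [|m IHm] gD; first by rewrite mdistxx mul0r.
apply: le_trans (metric_triangle _ (g m) _) _.
rewrite -natr1 mulrDl mul1r lerD ?gD//.
by apply: IHm => i im; apply/gD/leqW.
Qed.

(* Cut the path into a bounded number of pieces to which [nearest_contract]
   applies. *)
Lemma nearest_drift kappa (delta A eta D : R) :
  morse_gauge kappa -> 0 < delta -> 0 < A -> 0 < eta -> 0 < D ->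
  exists n0 : R, forall n, n0 <= n -> forall Y g m p q,
    closed Y -> morse kappa Y ->
    (forall i, (i < m)%N -> mdist (g i) (g i.+1) <= D) -> m%:R <= A * n ->
    (forall i y, (i <= m)%N -> Y y -> delta * n <= mdist (g i) y) ->
    nearest Y (g 0%N) p -> nearest Y (g m) q -> mdist (g 0%N) p <= A * n ->
    mdist p q <= eta * n.
Proof.
move=> gauge d0 A0 e0 D0.
pose k := (Num.truncn (8 * A * D / delta)).+1.
have k0 : 0 < k%:R :> R by rewrite ltr0n.
have kA : 8 * A * D < k%:R * delta by rewrite -ltr_pdivrMr// truncnS_gt.
pose A' := A * D + A.
have A'0 : 0 < A' by rewrite addr_gt0// mulr_gt0.
have [n1 contract] := nearest_contract X_geodesic gauge d0 A'0 (divr_gt0 e0 k0).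
exists (Num.max n1 (8 * D / delta)) => n; rewrite ge_max => /andP[n1n n2n].
move=> Y g m p q Yc Ym gD mA gfar up vq pA.
have nD : 8 * D <= n * delta by rewrite -ler_pdivrMr.
have n0 : 0 < n by rewrite -(pmulr_lgt0 _ d0); lra.
(* Pieces of [M] steps: M D <= delta n / 4 is what [nearest_contract] asks for, and M D >= delta n /
   8 ensures that [k] pieces cover the path. Each piece contributes eta n / k. *)
pose M := Num.truncn (delta * n / (4 * D)).
have MD : M%:R * D <= delta * n / 4.
  have : M%:R <= delta * n / (4 * D).
    by rewrite truncn_le// divr_ge0 ?mulr_ge0// ltW//; lra.
  by rewrite ler_pdivlMr; lra.
have MD' : delta * n / 8 <= M%:R * D.
  have : delta * n / (4 * D) < M.+1%:R by exact: truncnS_gt.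
  by rewrite -(@natr1 _ M) ltr_pdivrMr; lra.
have mkM : (m <= k * M)%N.
  rewrite -(ler_nat R) natrM; apply: le_trans mA _.
  have dD : 0 < delta * D by rewrite mulr_gt0.
  rewrite -(ler_pM2r dD).
  have : 8 * A * D * (delta * n / 8) <= k%:R * delta * (M%:R * D).
    apply: ler_pM => //; rewrite ?ltW//.
      by rewrite !mulr_gt0.
    by rewrite divr_gt0 ?mulr_gt0.
  lra.
have near i r : (i <= m)%N -> nearest Y (g i) r ->
    delta * n <= mdist (g i) r <= A' * n.
  move=> im [Yr ir]; rewrite gfar//=.
  apply: le_trans (ir p _) _; first by case: up.
  apply: le_trans (metric_triangle _ (g 0%N) _) _.
  have : mdist (g 0%N) (g i) <= i%:R * D.
    by apply: path_mdist_le => j ji; apply/gD/(leq_trans ji).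
  have : i%:R * D <= A * n * D.
    by rewrite ler_pM2r//; apply: le_trans mA; rewrite ler_nat.
  by rewrite (metric_sym (g i)) /A'; lra.
have short i j r t : (i <= j <= m)%N -> (j - i <= M)%N -> nearest Y (g i) r ->
    nearest Y (g j) t -> mdist r t <= eta / k%:R * n.
  move=> /andP[ij jm] jiM ir jt.
  apply: (contract n n1n Y (g i) (g j) r t Ym ir jt).
  - by apply: near => //; exact: leq_trans jm.
  - exact: near.
  - apply: le_trans MD.
    have := @path_mdist_le (fun l => g (i + l)%N) (j - i) D.
    rewrite addn0 subnKC// => /(_ _) h; apply: le_trans (h _) _.
      move=> l lij; rewrite addnS; apply: gD.
      by rewrite -ltn_subRL (leq_trans lij)// leq_sub2r.
    by rewrite ler_pM2r// ler_nat.
have ek : 0 < eta / k%:R * n by rewrite !mulr_gt0// invr_gt0.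
suff H j (i : nat) r : (i <= m)%N -> (m - i <= j.+1 * M)%N -> nearest Y (g i) r ->
    mdist r q <= j.+1%:R * (eta / k%:R * n).
  apply: le_trans (H k.-1 0%N p _ _ up) _ => //; first by rewrite subn0.
  by rewrite mulrA mulrCA mulfV ?mulr1// gt_eqF.
elim: j i r => [|j IHj] i r im mi ir.
  by rewrite mul1r; apply: (short i m) => //; rewrite ?im ?leqnn// -[M]mul1n.
have [miM|/ltnW Mmi] := leqP (m - i) M.
  apply: (@le_trans _ _ (eta / k%:R * n)).
    by apply: (short i m) => //; rewrite im leqnn.
  by rewrite ler_peMl ?ltW// ltr1n.
have iMm : (i + M <= m)%N by rewrite -leq_subRL.
have [t it] : exists t, nearest Y (g (i + M)%N) t.
  by apply: nearest_exists => //; exists p; case: up.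
apply: le_trans (metric_triangle r t q) _.
rewrite -natr1 mulrDl mul1r addrC lerD//.
  by apply: IHj it => //; rewrite subnDA leq_subLR -mulSn.
by apply: (short i (i + M)%N) => //; rewrite ?leq_addr ?iMm// addKn.
Qed.

(** Along a geodesic from [y1] to [y2], which the Morse property keeps near Y, the projections
    switch from [Y1] to [Y2] within unit length; narrowness at the switch puts z near both. *)
Lemma narrow_near kappa (s : R) : morse_gauge kappa -> 0 <= s ->
  exists2 C : R, 0 <= C & forall (Y1 Y2 : set X) z y1 y2,
    closed (Y1 `|` Y2) -> morse kappa (Y1 `|` Y2) -> narrow s Y1 Y2 z ->
    Y1 y1 -> Y2 y2 -> exists2 y, (Y1 `|` Y2) y & mdist z y <= C.
Proof.
move=> gauge s0; have k1 : 0 <= kappa 1 by apply: gauge; rewrite lexx.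
exists (2 * kappa 1 + 1 + s); first by lra.
move=> Y1 Y2 z y1 y2 Yc Ym narrowY Yy1 Yy2.
have [g [g0 gl gE]] := geodesic_unit_speed y1 y2 X_geodesic.
set l := mdist y1 y2 in gl gE; have l0 : 0 <= l := mdist_ge0 _ _.
have in_nbhd t : 0 <= t <= l -> (edist_inf (Y1 `|` Y2) (g t) <= (kappa 1)%:E)%E.
  move=> tl; apply: (Ym 1 (lexx _) 0 l) => //.
  - move=> a b; rewrite !in_itv/= => /andP[a0 al] /andP[b0 bl].
    rewrite invr1 !mul1r; have [ab|/ltW ba] := leP a b.
      by rewrite distrC ger0_norm ?subr_ge0// gE ?a0//; lra.
    by rewrite ger0_norm ?subr_ge0// metric_sym gE ?b0//; lra.
  - by rewrite g0; left.
  - by rewrite gl; right.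
have near t : exists p, nearest (Y1 `|` Y2) (g t) p.
  by apply: nearest_exists => //; exists y1; left.
have [P PP] := choice near.
have near_le t : 0 <= t <= l -> mdist (g t) (P t) <= kappa 1.
  by move=> /in_nbhd; rewrite (edist_inf_nearest (PP t)) lee_fin.
have fix_ y t : g t = y -> (Y1 `|` Y2) y -> P t = y.
  move=> gt Yy; have [_ /(_ y Yy)] := PP t; rewrite gt mdistxx => h.
  apply/esym/mdist_positivity/eqP; rewrite eq_le h mdist_ge0//.
pose N := Num.truncn l.
have lN : l < N.+1%:R by exact: truncnS_gt.
pose T (i : nat) : R := Num.min i%:R l.
have T0l i : 0 <= T i <= l by rewrite /T le_min ler0n l0/= ge_min lexx orbT.
have [||i iN|m [mN Y1m Y2m]] := @first_switch X (P \o T) Y1 Y2 N.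
- by rewrite /= (fix_ y1)//; [rewrite /T min_l|left].
- by rewrite /= (fix_ y2)//; [rewrite /T min_r// ltW|right].
- by case: (PP (T i)).
have /= nYz := narrowY _ _ (Y1m m (leqnn m)) Y2m.
have Tm : 0 <= T m <= T m.+1.
  by case/andP: (T0l m) => -> _ /=; rewrite /T le_min !ge_min lexx orbT andbT ler_nat leqnSn.
have Tm1 : T m.+1 <= T m + 1.
  by rewrite /T -(@natr1 _ m); case: (leP (m%:R + 1) l) => ?; case: (leP m%:R l) => ?; lra.
exists (P (T m)); first by left; exact: Y1m.
have gTm : mdist (g (T m)) (g (T m.+1)) <= 1.
  by case/andP: (T0l m.+1) => _ ?; rewrite gE//; lra.
have := metric_triangle (P (T m)) (g (T m)) (P (T m.+1)).
have := metric_triangle (g (T m)) (g (T m.+1)) (P (T m.+1)).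
have := near_le _ (T0l m); have := near_le _ (T0l m.+1).
have := mdist_ge0 z (P (T m.+1)).
by rewrite (metric_sym z (P (T m))) (metric_sym (P (T m)) (g _)); lra.
Qed.

(* Follow the path back from its end to the last visit near [Y]: by then the
   projection has hardly moved. *)
Lemma backtrack kappa (A D K C e : R) :
  morse_gauge kappa -> 0 < A -> 0 < D -> 0 <= K -> 0 <= C -> 0 < e ->
  exists n0 : R, forall n, n0 <= n -> forall Y z y0 g m p q lambda,
    closed Y -> morse kappa Y -> Y y0 -> mdist z y0 <= C ->
    (forall i, (i < m)%N -> mdist (g i) (g i.+1) <= D) -> m%:R <= A * n ->
    nearest Y (g 0%N) p -> mdist (g 0%N) p <= K * (mdist p z + 1) ->
    mdist (g 0%N) z <= n ->
    nearest Y (g m) q -> mdist q z <= lambda * n ->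
    (exists2 j, (j <= m)%N & mdist (g j) z <= (lambda + e) * n) \/
    mdist (g 0%N) z <= (K + 1) * ((lambda + e) * n) + K.
Proof.
move=> gauge A0 D0 K0 C0 e0.
have e2 : 0 < e / 2 by lra.
have e4 : 0 < e / 4 by lra.
have A'0 : 0 < A + 2 + e by lra.
have [n1 drift] := nearest_drift gauge e2 A'0 e4 D0.
exists (Num.max (Num.max n1 (8 * D / e)) (Num.max C 1)) => n.
rewrite !ge_max => /andP[/andP[n1n]]; rewrite ler_pdivrMr// => Dn /andP[Cn n1'].
have n0 : 0 < n by lra.
have en : 0 < e * n by rewrite mulr_gt0.
have An : 0 < A * n by rewrite mulr_gt0.
move=> Y z y0 g m p q lambda Yc Ym Yy0 zy0 gD mA up pK pn vq qz.
have mA' : m%:R <= (A + 2 + e) * n by lra.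
have pA : mdist (g 0%N) p <= (A + 2 + e) * n.
  have [_ /(_ _ Yy0)] := up; have := metric_triangle (g 0%N) z y0; lra.
(* If the path never comes close to Y, the projection drifts little from p to q, so p is near z, and
   the assumption on p bounds d(g 0, z). *)
have [far|[j [jm [y [Yy jy]] far]]] := last_occurrence
    (fun i => exists y, Y y /\ mdist (g i) y < e / 2 * n) m.
  right.
  have pq : mdist p q <= e / 4 * n.
    apply: (drift n n1n Y g m p q) => // i y im Yy; rewrite leNgt; apply/negP => iy.
    by apply: (far i im); exists y.
  have pz : mdist p z <= (lambda + e) * n.
    by have := metric_triangle p q z; lra.
  have := metric_triangle (g 0%N) p z; have := ler_wpM2l K0 pz; lra.
left; exists j => //.
(* The drift estimate starts at j + 1, the first vertex after which the path stays far from Y; for j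
   = m no such vertex exists, but [g m] is then close to q. *)
move: jm; rewrite leq_eqVlt => /orP[/eqP jE|jm].
  subst j; have [_ /(_ _ Yy)] := vq; have := metric_triangle (g m) q z; lra.
have [r jr] : exists r, nearest Y (g j.+1) r.
  by apply: nearest_exists => //; exists p; case: up.
have [_ /(_ _ Yy) jry] := jr.
have gj := gD j jm.
have := metric_triangle (g j.+1) (g j) y; rewrite (metric_sym (g j.+1) (g j)) => jy'.
have rq : mdist r q <= e / 4 * n.
  apply: (drift n n1n Y (fun i => g (j.+1 + i)%N) (m - j.+1)%N r q) => //.
  - by move=> i im; rewrite addnS; apply: gD; rewrite -ltn_subRL.
  - by apply: le_trans mA'; rewrite ler_nat leq_subr.
  - move=> i y' im Yy'; rewrite leNgt; apply/negP => iy.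
    apply: (far (j.+1 + i)%N); last by exists y'.
    by rewrite leq_addr/= -leq_subRL.
  - by rewrite addn0.
  - by rewrite subnKC.
  - by rewrite addn0; lra.
have := metric_triangle (g j) (g j.+1) z; have := metric_triangle (g j.+1) r z.
have := metric_triangle r q z; lra.
Qed.

(** The one-point form of antipodality; + 1 leaves room for additive errors near z. *)
Definition cone (K : R) Y (Y1 : set X) (z x : X) := exists p,
  [/\ nearest Y x p, Y1 p & mdist x p <= K * (mdist p z + 1)].

(** When the projection first switches from [Y1] to [Y2], narrowness puts it near z, and [backtrack]
    yields an earlier vertex near z. The first vertex i in the ball of radius n / 4 is the required
    one. If it violated the cone condition, its projection would be much closer to z than n / 4, and
    [backtrack] from i would give a vertex deep inside the ball: an earlier one contradicts the
    choice of i, and i itself cannot be that deep since one step has length at most [D]. *)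
Lemma crossing kappa (s K A D : R) :
  morse_gauge kappa -> 0 <= s -> 4 <= K -> 0 < A -> 0 < D ->
  exists n0 : R, forall n, n0 <= n -> forall (Y1 Y2 : set X) z g L,
    closed (Y1 `|` Y2) -> morse kappa (Y1 `|` Y2) -> narrow s Y1 Y2 z ->
    cone K (Y1 `|` Y2) Y1 z (g 0%N) -> cone K (Y1 `|` Y2) Y2 z (g L) ->
    (forall i, (i < L)%N -> mdist (g i) (g i.+1) <= D) -> L%:R <= A * n ->
    n / 2 <= mdist (g 0%N) z <= n ->
    exists2 i, (i <= L)%N &
      cone K (Y1 `|` Y2) Y1 z (g i) /\ mdist (g i) z <= n / 4.
Proof.
move=> gauge s0 K4 A0 D0.
have [C1 C10 near_z] := narrow_near gauge s0.
have Kn0 : K != 0 by rewrite gt_eqF//; lra.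
(* Failure of the cone condition at i gives K d(P i, z) < n / 4 + C1 <= n / 3 = 8 e n K. *)
pose e := (24 * K)^-1.
have eK : e * (24 * K) = 1 by rewrite /e mulVf// mulf_neq0// pnatr_eq0.
have e0 : 0 < e by rewrite invr_gt0; lra.
clearbody e.
have e96 : e * 96 <= 1.
  by rewrite -eK ler_pM2l//; lra.
have DA : 0 < D * A by rewrite mulr_gt0.
pose theta := e / (4 * (D * A + 2)).
have thE : theta * (4 * (D * A + 2)) = e by rewrite divfK// gt_eqF//; lra.
have th0 : 0 < theta by rewrite divr_gt0//; lra.
have th01 : 0 < theta <= 1 by rewrite th0/= ler_pdivrMr; lra.
have [C2 C20 lip] := nearest_mdist_le X_geodesic gauge th01.
have K0 : 0 <= K by lra.
have [n1 back] := backtrack gauge A0 D0 K0 C10 e0.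
(* The summands make the additive errors in [Pmz] at most e n / 2, and give C1 <= n / 12, D < n / 8
   and K <= n / 40. The last one excludes d(g 0, z) <= (K + 1) 9 e n + K, whose right side is below
   n / 2. *)
exists (Num.max n1 ((D + C2 + s + 1) / e * 2 + 12 * C1 + 8 * D + 40 * K)) => n.
rewrite ge_max => /andP[n1n n2n].
have De0 : 0 <= (D + C2 + s + 1) / e by rewrite divr_ge0//; lra.
have nC : 12 * C1 <= n by move: (_ / e) De0 n2n => ? ? ?; lra.
have nD : 8 * D < n by move: (_ / e) De0 n2n => ? ? ?; lra.
have nK : 40 * K <= n by move: (_ / e) De0 n2n => ? ? ?; lra.
have nCe : 2 * (D + C2 + s) <= e * n.
  have : (D + C2 + s + 1) / e * 2 <= n by move: (_ / e) De0 n2n => ? ? ?; lra.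
  by rewrite mulrAC ler_pdivrMr//; lra.
move=> Y1 Y2 z g L Yc Ym narrowY [p [up Y1p pK]] [q [vq Y2q qK]] gD LA gn.
set Y := Y1 `|` Y2 in Yc Ym up vq *.
have [y0 Yy0 zy0] := near_z Y1 Y2 z p q Yc Ym narrowY Y1p Y2q.
have near u : exists r, nearest Y u r by apply: nearest_exists => //; exists y0.
have [Pr PrP] := choice near.
(* The last vertex is repeated, so that the prescribed projections p and q sit at the distinct
   indices 0 and L + 1 even when L = 0. *)
pose h i := g (minn i L).
pose P i := if i == 0%N then p else if (i <= L)%N then Pr (g i) else q.
have hP i : (i <= L.+1)%N -> nearest Y (h i) (P i).
  rewrite /h /P; case: i => [|i]; first by rewrite min0n.
  move=> /= iL; have [iL'|Li] := ltnP i L; first by rewrite (minn_idPl iL').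
  by rewrite (minn_idPr (leqW Li)).
have hg i : (i <= L)%N -> h i = g i by rewrite /h => /minn_idPl ->.
have Yp : Y p by left.
have P_le i : (i <= L.+1)%N -> mdist (h i) (P i) <= D * A * n + 2 * n.
  move=> iL; have [_ /(_ _ Yp)] := hP i iL.
  have [_ /(_ _ Yy0)] := up; have := metric_triangle (g 0%N) z y0.
  have := metric_triangle (h i) (g 0%N) p; rewrite (metric_sym (h i) (g 0%N)).
  have : mdist (g 0%N) (h i) <= (minn i L)%:R * D.
    apply: path_mdist_le => l lm; apply: gD; apply: leq_trans lm _.
    exact: geq_minr.
  have : (minn i L)%:R * D <= A * n * D.
    by rewrite ler_pM2r//; apply: le_trans LA; rewrite ler_nat geq_minr.
  by rewrite -/(h i); lra.
have [||i iL|m [mL Y1m Y2m]] := @first_switch X P Y1 Y2 L.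
- by [].
- by rewrite /P/= ltnn.
- by have [] := hP i (leqW iL).
have gm m' : (m' <= m)%N -> nearest Y (g m') (P m').
  by move=> m'm; have m'L := leq_trans m'm mL; rewrite -hg//; apply/hP/leqW.
have hD : mdist (h m) (h m.+1) <= D.
  rewrite (hg m)//; move: mL; rewrite leq_eqVlt => /orP[/eqP mE|mL].
    by rewrite /h mE (minn_idPr (leqnSn L)) mdistxx ltW.
  by rewrite hg// gD.
have Pmz : mdist (P m) z <= e * n.
  have := narrowY _ _ (Y1m m (leqnn m)) Y2m; have := mdist_ge0 z (P m.+1).
  have := lip Y _ _ _ _ Ym (hP m (leqW mL)) (hP m.+1 mL).
  have := ler_wpM2l (ltW th0) (P_le m (leqW mL)).
  have := ler_wpM2l (ltW th0) (P_le m.+1 mL).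
  have : theta * (4 * (D * A + 2)) * n = e * n by rewrite thE.
  lra.
have gDm m' : (m' <= m)%N -> forall i, (i < m')%N -> mdist (g i) (g i.+1) <= D.
  by move=> m'm i im; apply: gD; rewrite (leq_trans im)// (leq_trans m'm).
have mA m' : (m' <= m)%N -> m'%:R <= A * n.
  by move=> m'm; apply: le_trans LA; rewrite ler_nat (leq_trans m'm).
have en96 : e * n * 96 <= n.
  have n0' : 0 <= n by apply: le_trans nK; rewrite mulr_ge0.
  by rewrite mulrAC ler_piMl.
have enK : e * n * 24 * K = n.
  by rewrite (_ : e * n * 24 * K = e * (24 * K) * n); [rewrite eK mul1r|ring].
have [gn1 gn2] := andP gn.
have [[j jm jz]|] := back n n1n Y z y0 g m p (P m) e Yc Ym Yy0 zy0 (gDm m (leqnn m))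
    (mA m (leqnn m)) up pK gn2 (gm m (leqnn m)) Pmz; last by lra.
have ex_i : exists i, `[< (i <= m)%N /\ mdist (g i) z <= n / 4 >].
  by exists j; apply/asboolP; split => //; lra.
have := ex_minnP ex_i; case=> i /asboolP[im iz] imin.
exists i; first exact: leq_trans mL.
split => //; exists (P i); split; [exact: gm|exact: Y1m|rewrite leNgt; apply/negP => iK].
have before l : (l < i)%N -> n / 4 < mdist (g l) z.
  move=> li; rewrite ltNge; apply/negP => lz.
  suff : (i <= l)%N by rewrite leqNgt li.
  by apply/imin/asboolP; split => //; exact/ltnW/(leq_trans li).
have [_ /(_ _ Yy0) iPi] := gm i im.
have T1 := metric_triangle (g i) z y0.
have Piz : mdist (P i) z <= 8 * e * n.
  have : K * mdist (P i) z <= K * (8 * e * n) by lra.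
  by rewrite ler_pM2l//; lra.
have [[j' j'i j'z]|] := back n n1n Y z y0 g i p (P i) (8 * e) Yc Ym Yy0 zy0 (gDm i im)
    (mA i im) up pK gn2 (gm i im) Piz; last by lra.
move: j'i; rewrite leq_eqVlt => /orP[/eqP j'E|/before]; last by lra.
case: i im iz imin iK before iPi T1 Piz j'E => [|i] im iz imin iK before iPi T1 Piz j'E.
  by move: j'z; rewrite j'E; lra.
have := before i (ltnSn i); have := gDm _ im i (ltnSn i).
have := metric_triangle (g i) (g i.+1) z.
by move: j'z; rewrite j'E; lra.
Qed.

End Crossing.

(** * Ancona inequality *)

(** With u = v = x, [nearest_mdist_le] bounds the diameter of the projection of x by a small
    multiple of d(x, Y) plus a constant; the choice of [theta] lets this multiple, times k, be
    absorbed on the left. *)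
Lemma antipodal_cone (R : realType) (X : metricType R) (kappa : R -> R) (k : R) :
  proper_space X -> geodesic_space X -> morse_gauge kappa -> 0 <= k ->
  exists2 K : R, 4 <= K & forall (Y Y1 : set X) z x,
    closed Y -> morse kappa Y -> projection Y x `<=` Y1 ->
    (edist_inf Y x <= k%:E * diam (projection Y x `|` [set z]))%E ->
    cone K Y Y1 z x.
Proof.
move=> Xp Xg gauge k0; pose theta := (8 * (k + 1))^-1.
have thE : theta * (8 * (k + 1)) = 1 by rewrite mulVf// gt_eqF//; lra.
have th0 : 0 < theta by rewrite invr_gt0; lra.
have th01 : 0 < theta <= 1 by rewrite th0 /theta invf_le1; lra.
have [C C0 lip] := nearest_mdist_le Xg gauge th01.
clearbody theta.
have kC : 0 <= k * C by rewrite mulr_ge0.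
exists (4 + 4 * k + 4 * (k * C)); first lra.
move=> Y Y1 z x Yc Ym xY1 xk.
have bound (r : R) : 0 <= r ->
    (forall p p', nearest Y x p -> nearest Y x p' -> mdist p p' <= r) ->
    (forall p, nearest Y x p -> mdist p z <= r) -> (edist_inf Y x <= (k * r)%:E)%E.
  move=> r0 pp pz; apply: le_trans xk _; rewrite EFinM lee_wpmul2l ?lee_fin//.
  apply: ge_ereal_sup => _ [p [q [pP qP ->]]]; rewrite lee_fin.
  case: pP qP => [/projectionP pP|->] [/projectionP qP|->].
  - exact: pp.
  - exact: pz.
  - by rewrite metric_sym; exact: pz.
  - by rewrite mdistxx.
(* For empty Y the distance is +oo while the diameter of {z} is 0. *)
have [Y0|/set0P Y0] := eqVneq Y set0.
  have : (edist_inf Y x <= (k * 0)%:E)%E.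
    by apply: bound => // [p p'|p] [+ _]; rewrite Y0.
  by rewrite Y0 /edist_inf image_set0 ereal_inf0.
have [p xp] := nearest_exists x Xp Yc Y0.
exists p; split => //; first by apply/xY1/projectionP.
have pz0 := mdist_ge0 p z; have xp0 := mdist_ge0 x p.
have near_p q q' : nearest Y x q -> nearest Y x q' ->
    mdist q q' <= theta * (2 * mdist x p) + C.
  move=> xq xq'; have := lip Y x x q q' Ym xq xq'; rewrite mdistxx.
  have [_ xqY] := xq; have [_ xq'Y] := xq'.
  have xqp : mdist x q <= mdist x p by apply: xqY; case: xp.
  have xq'p : mdist x q' <= mdist x p by apply: xq'Y; case: xp.
  have := ler_wpM2l (ltW th0) (lerD xqp xq'p); lra.
have thx : 0 <= theta * (2 * mdist x p) by rewrite !mulr_ge0// ltW.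
have := bound (mdist p z + (theta * (2 * mdist x p) + C)) _ _ _.
rewrite (edist_inf_nearest xp) lee_fin => h.
have {h} : mdist x p <= k * (mdist p z + (theta * (2 * mdist x p) + C)).
  apply: h; first lra.
    by move=> q q' xq xq'; have := near_p q q' xq xq'; lra.
  move=> q xq; have := near_p q p xq xp; have := metric_triangle q p z; lra.
have : theta * (8 * (k + 1)) * mdist x p = mdist x p by rewrite thE mul1r.
have : 0 <= theta * mdist x p by rewrite mulr_ge0// ltW.
have := mulr_ge0 kC pz0; have := mulr_ge0 k0 pz0; lra.
Qed.

Section AnconaStep.
Context {R : realType} {X : metricType R} {V I : eqType}.
Variables (S : seq I) (w : I -> R) (a : I -> V -> V) (p : nat -> V -> V -> R).
Variables (pt : V -> X) (C rho c D : R).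
Hypothesis X_geodesic : geodesic_space X.
Hypothesis X_proper : proper_space X.
Hypothesis pW : walk_kernel S w a p.
Hypothesis rho01 : 0 <= rho < 1.
Hypothesis decay : forall n x y, p n x y <= C * rho ^+ n.
Hypothesis c01 : 0 < c <= 1.
Hypothesis potential_lower : forall x y (m : nat),
  mdist (pt x) (pt y) <= m%:R -> c ^+ m.+2 <= potential p 1 x y.
Hypothesis D_gt0 : 0 < D.
Hypothesis stepD : forall x i, i \in S -> mdist (pt x) (pt (a i x)) <= D.

Local Notation G := (potential p 1).

Lemma small_power (e : R) : 0 < e -> exists A : nat, rho ^+ A <= e.
Proof.
move=> e0; have [r0 r1] := andP rho01.
have : (fun n => rho ^+ n) @ \oo --> (0 : R).
  by apply: cvg_expr; rewrite ger0_norm.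
move=> /cvgr_le/(_ e e0)[A _ /(_ A)] h; exists A; apply: h => /=; exact: leqnn.
Qed.

(* A path from [x] to [y] that avoids the cone points at distance at most
   [2 ^ m / 4] of [z] has length more than [A 2 ^ m], so that the corresponding
   part of the Green function is negligible; the maximum principle controls the
   rest. *)
Lemma ancona_step (kappa : R -> R) (s K : R) :
  morse_gauge kappa -> 0 <= s -> 4 <= K ->
  exists m0 : nat, forall m, (m0 <= m)%N -> forall Y1 Y2 x y z M,
    closed (Y1 `|` Y2) -> morse kappa (Y1 `|` Y2) -> narrow s Y1 Y2 (pt z) ->
    cone K (Y1 `|` Y2) Y1 (pt z) (pt x) -> cone K (Y1 `|` Y2) Y2 (pt z) (pt y) ->
    (2 ^ m)%:R / 2 <= mdist (pt x) (pt z) <= (2 ^ m)%:R ->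
    mdist (pt y) (pt z) <= (2 ^ m)%:R -> 0 <= M ->
    (forall u, cone K (Y1 `|` Y2) Y1 (pt z) (pt u) ->
      mdist (pt u) (pt z) <= (2 ^ m)%:R / 4 -> G u y <= M * (G u z * G z y)) ->
    G x y <= (M + 2^-1 ^+ m) * (G x z * G z y).
Proof.
move=> gauge s0 K4; have [c0 c1] := andP c01; have [rho0 rho1] := andP rho01.
(* At length A N the tail is of order c^(2N) 4^-N, against a product of Green functions at least
   c^(2N + 4). One factor 2^-N absorbs the constant [B], and the other gives the summable error. *)
have [A rhoA] : exists A : nat, rho ^+ A <= c ^+ 2 / 4.
  by apply: small_power; rewrite divr_gt0// exprn_gt0.
have A'0 : 0 < A.+1%:R :> R by rewrite ltr0n.
have rhoA' : rho ^+ A.+1 <= c ^+ 2 / 4.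
  by rewrite exprS; apply: le_trans rhoA; rewrite ler_piMl ?exprn_ge0// ltW.
have [n0 cross] := crossing X_geodesic X_proper gauge s0 K4 A'0 D_gt0.
pose B := C / (1 - rho) / c ^+ 4.
exists (Num.truncn (Num.max n0 B)).+1 => m m0m Y1 Y2 x y z M Yc Ym nY cx cy xz yz M0 HM.
set N := (2 ^ m)%N in xz yz HM *.
have mN : (m <= N)%N by rewrite ltnW// ltn_expl.
have : Num.max n0 B <= N%:R.
  apply: ltW; apply: lt_le_trans (truncnS_gt _) _.
  by rewrite ler_nat (leq_trans m0m).
rewrite ge_max => /andP[n0N BN].
pose U := [set u | cone K (Y1 `|` Y2) Y1 (pt z) (pt u) /\ mdist (pt u) (pt z) <= N%:R / 4].
(* A surviving path of such a length would contradict [crossing] at scale N. *)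
have killed0 n : (n <= A.+1 * N)%N -> killed_walk S w a U n x y = 0.
  move=> nAN; apply/eqP/negPn/negP => /killed_walk_path[g [g0 gn gU gS]].
  have [||i|||i iL iU] := cross N%:R n0N Y1 Y2 (pt z) (pt \o g) n Yc Ym nY.
  - by rewrite /= g0.
  - by rewrite /= gn.
  - by move=> /gS[t tS gt] /=; rewrite gt; exact: stepD.
  - by rewrite -natrM ler_nat.
  - by rewrite /= g0.
  - exact: (gU i iL).
have tail : C * (rho ^+ (A.+1 * N) / (1 - rho)) <= 2^-1 ^+ m * (G x z * G z y).
  have GG : c ^+ N.+2 * c ^+ N.+2 <= G x z * G z y.
    have cN0 : 0 <= c ^+ N.+2 by rewrite exprn_ge0// ltW.
    apply: ler_pM => //; apply: potential_lower; first by case/andP: xz.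
    by rewrite metric_sym.
  have C0 : 0 <= C / (1 - rho).
    by rewrite divr_ge0 ?subr_ge0 ?(ltW rho1)//; exact: (decay_ge0 pW decay x).
  rewrite mulrA mulrAC exprM.
  apply: (@le_trans _ _ (C / (1 - rho) * (c ^+ 2 / 4) ^+ N)).
    by rewrite ler_wpM2l// lerXn2r// nnegrE ?exprn_ge0// divr_ge0// exprn_ge0// ltW.
  have CB : C / (1 - rho) <= c ^+ 4 * 2 ^+ N.
    rewrite -ler_pdivrMl ?exprn_gt0// mulrC; apply: le_trans BN _.
    by rewrite -natrX ler_nat ltnW// ltn_expl.
  apply: (@le_trans _ _ (c ^+ 4 * 2 ^+ N * (c ^+ 2 / 4) ^+ N)).
    by rewrite ler_wpM2r// exprn_ge0// divr_ge0// exprn_ge0// ltW.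
  have -> : c ^+ 4 * 2 ^+ N * (c ^+ 2 / 4) ^+ N = 2^-1 ^+ N * (c ^+ N.+2 * c ^+ N.+2).
    have -> : c ^+ N.+2 * c ^+ N.+2 = c ^+ 4 * (c ^+ 2) ^+ N.
      by rewrite -exprD -exprM -exprD; congr (_ ^+ _); rewrite mul2n -addnn !addSn !addnS.
    have e : 2 ^+ N * (c ^+ 2 / 4) ^+ N = 2^-1 ^+ N * (c ^+ 2) ^+ N.
      by rewrite -!exprMn; congr (_ ^+ N); field.
    by rewrite -mulrA e mulrCA.
  have h0 : 0 <= 2^-1 :> R by rewrite invr_ge0.
  apply: ler_pM GG; [by rewrite exprn_ge0|by rewrite mulr_ge0// exprn_ge0// ltW|].
  by rewrite ler_wiXn2l// invf_le1// ler1n.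
rewrite mulrDl addrC; apply: (potential1_le pW rho01 decay) => n.
have Gge0 u v : 0 <= G u v by exact: (potential1_ge0 pW rho01 decay).
apply: le_trans (@maximum_principle _ _ _ _ _ _ _ pW U
  (fun u => M * (G u z * G z y)) y _ _ _ n x) _.
- by move=> u; rewrite !mulr_ge0.
- move=> u; rewrite (_ : \sum_(i <- S) _ =
    M * G z y * \sum_(i <- S) w i * G (a i u) z); last first.
    by rewrite mulr_sumr; apply: eq_bigr => i _; ring.
  rewrite [G u z * _]mulrC mulrA ler_wpM2l ?mulr_ge0//.
  exact: (potential1_superharmonic pW rho01 decay).
- move=> n' u [cu uz]; apply: le_trans (HM u cu uz).
  exact: (partial_le_potential1 pW rho01 decay).
rewrite lerD2r; apply: le_trans tail.
exact: (killed_walk_tail pW rho01 decay).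
Qed.

End AnconaStep.

Section AnconaInequality.
Context {R : realType} {X : metricType R} {V I : eqType}.
Variables (S : seq I) (w : I -> R) (a a' : I -> V -> V) (p : nat -> V -> V -> R).
Variables (pt : V -> X) (C rho c D : R).
Hypothesis X_geodesic : geodesic_space X.
Hypothesis X_proper : proper_space X.
Hypothesis pW : walk_kernel S w a p.
Hypothesis p'W : walk_kernel S w a' (fun n x y => p n y x).
Hypothesis rho01 : 0 <= rho < 1.
Hypothesis decay : forall n x y, p n x y <= C * rho ^+ n.
Hypothesis c01 : 0 < c <= 1.
Hypothesis potential_lower : forall x y (m : nat),
  mdist (pt x) (pt y) <= m%:R -> c ^+ m.+2 <= potential p 1 x y.
Hypothesis D_gt0 : 0 < D.
Hypothesis stepD : forall x i, i \in S -> mdist (pt x) (pt (a i x)) <= D.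
Hypothesis stepD' : forall x i, i \in S -> mdist (pt x) (pt (a' i x)) <= D.

Local Notation G := (potential p 1).

(* [ancona_step] for the walk (resp. the reversed walk) divides the scale of [x]
   (resp. [y]) by two; the errors form a convergent series. *)
Lemma cone_ancona (kappa : R -> R) (s K : R) :
  morse_gauge kappa -> 0 <= s -> 4 <= K ->
  exists2 M : R, 0 <= M & forall Y1 Y2 x y z,
    closed (Y1 `|` Y2) -> morse kappa (Y1 `|` Y2) -> narrow s Y1 Y2 (pt z) ->
    cone K (Y1 `|` Y2) Y1 (pt z) (pt x) -> cone K (Y1 `|` Y2) Y2 (pt z) (pt y) ->
    G x y <= M * (G x z * G z y).
Proof.
move=> gauge s0 K4; have [c0 c1] := andP c01.
have [m1 step] := ancona_step X_geodesic X_proper pW rho01 decay c01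
  potential_lower D_gt0 stepD gauge s0 K4.
have decay' n x y : p n y x <= C * rho ^+ n by exact: decay.
have potential_lower' x y (m : nat) : mdist (pt x) (pt y) <= m%:R ->
    c ^+ m.+2 <= potential (fun n x y => p n y x) 1 x y.
  by move=> xy; apply: potential_lower; rewrite metric_sym.
have [m2 step'] := ancona_step X_geodesic X_proper p'W rho01 decay' c01
  potential_lower' D_gt0 stepD' gauge s0 K4.
pose m0 := maxn m1 m2; pose N0 := (2 ^ m0)%N.
pose B := `|C / (1 - rho)|; pose M0 := B / (c ^+ N0.+2 * c ^+ N0.+2).
have cN : 0 < c ^+ N0.+2 * c ^+ N0.+2 by rewrite mulr_gt0 ?exprn_gt0.
have M00 : 0 <= M0 by apply: divr_ge0; [exact: normr_ge0|exact: ltW].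
(* [Mm] grows by 2 * 2^-(n+1) from n to n + 1: one error for halving the scale of x and one for that
   of y. *)
pose Mm m := M0 + (2 - 2 * 2^-1 ^+ m).
have half_ge0 m : 0 <= 2^-1 ^+ m :> R by rewrite exprn_ge0// invr_ge0.
have half_le1 m : 2^-1 ^+ m <= 1 :> R.
  by rewrite exprn_ile1 ?invr_ge0// invf_le1 ?ler1n.
have Mm0 m : 0 <= Mm m by have := half_le1 m; rewrite /Mm; lra.
have Gge0 u v : 0 <= G u v by exact: (potential1_ge0 pW rho01 decay).
have GG0 u v u' v' : 0 <= G u v * G u' v' by rewrite mulr_ge0.
exists (M0 + 2); first lra.
move=> Y1 Y2 x y z Yc Ym nY.
have Yc' : closed (Y2 `|` Y1) by rewrite setUC.
have Ym' : morse kappa (Y2 `|` Y1) by rewrite setUC.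
have nY' : narrow s Y2 Y1 (pt z).
  move=> y2 y1 Yy2 Yy1; have := nY y1 y2 Yy1 Yy2.
  by rewrite (metric_sym y1 (pt z)) (metric_sym (pt z) y2) (metric_sym y1) addrC.
have coneC (W : set X) u : cone K (Y2 `|` Y1) W (pt z) u <-> cone K (Y1 `|` Y2) W (pt z) u.
  by rewrite setUC.
suff H m : (m0 <= m)%N -> forall x y,
    cone K (Y1 `|` Y2) Y1 (pt z) (pt x) -> cone K (Y1 `|` Y2) Y2 (pt z) (pt y) ->
    mdist (pt x) (pt z) <= (2 ^ m)%:R -> mdist (pt y) (pt z) <= (2 ^ m)%:R ->
    G x y <= Mm m * (G x z * G z y).
  move=> cx cy; pose r := mdist (pt x) (pt z) + mdist (pt y) (pt z).
  have x0 := mdist_ge0 (pt x) (pt z); have y0 := mdist_ge0 (pt y) (pt z).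
  pose m := maxn m0 (Num.truncn r).+1.
  have rm : r <= (2 ^ m)%:R.
    apply/ltW/(lt_le_trans (truncnS_gt _)); rewrite ler_nat.
    by apply: (@leq_trans m); [exact: leq_maxr|rewrite ltnW// ltn_expl].
  apply: le_trans (H m (leq_maxl _ _) x y cx cy _ _) _; [by rewrite /r in rm; lra..|].
  by rewrite ler_wpM2r// /Mm; have := half_ge0 m; lra.
move=> m0m; rewrite -(subnKC m0m); elim: (m - m0)%N => [|k IHk] {}x {}y cx cy.
  rewrite addn0 -/N0 => xz yz.
  apply: (@le_trans _ _ B).
    apply: le_trans (ler_norm _); exact: (potential1_bounded pW rho01 decay).
  apply: (@le_trans _ _ (M0 * (G x z * G z y))).
    rewrite -[leLHS](divfK (lt0r_neq0 cN)) -/M0 ler_wpM2l//.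
    have cN0 : 0 <= c ^+ N0.+2 by rewrite exprn_ge0// ltW.
    apply: ler_pM => //; apply: potential_lower => //.
    by rewrite metric_sym.
  by rewrite ler_wpM2r// /Mm; have := half_le1 m0; lra.
rewrite addnS; set n := (m0 + k)%N in IHk *.
have natS : (2 ^ n.+1)%:R = 2 * (2 ^ n)%:R :> R by rewrite expnS natrM.
have n0 : 0 <= (2 ^ n)%:R :> R by [].
have m1n : (m1 <= n.+1)%N by rewrite (leq_trans (leq_maxl m1 m2))// leqW// leq_addr.
have m2n : (m2 <= n.+1)%N by rewrite (leq_trans (leq_maxr m1 m2))// leqW// leq_addr.
have halfS : 2^-1 ^+ n.+1 = 2^-1 ^+ n / 2 :> R by rewrite exprS mulrC.
(* Mixed scales: the first point is already at scale n, and the reversed walk brings the second one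
   there. *)
have near_x u v : cone K (Y1 `|` Y2) Y1 (pt z) (pt u) ->
    cone K (Y1 `|` Y2) Y2 (pt z) (pt v) ->
    mdist (pt u) (pt z) <= (2 ^ n)%:R -> mdist (pt v) (pt z) <= (2 ^ n.+1)%:R ->
    G u v <= (Mm n + 2^-1 ^+ n.+1) * (G u z * G z v).
  move=> cu cv uz vz; have [vn|/ltW nv] := leP (mdist (pt v) (pt z)) (2 ^ n)%:R.
    apply: le_trans (IHk u v cu cv uz vn) _.
    by rewrite ler_wpM2r// lerDl.
  rewrite [G u z * _]mulrC.
  apply: (step' n.+1 m2n Y2 Y1 v u z (Mm n)) => //; [exact/coneC|exact/coneC|lra|lra|].
  move=> t /coneC ct tz; rewrite [_ * potential _ _ _ _]mulrC; apply: IHk => //.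
  by apply: le_trans tz _; lra.
move=> xz yz; have [xn|/ltW nx] := leP (mdist (pt x) (pt z)) (2 ^ n)%:R.
  apply: le_trans (near_x x y cx cy xn yz) _.
  by rewrite ler_wpM2r// /Mm halfS; have := half_ge0 n; lra.
have -> : Mm n.+1 = (Mm n + 2^-1 ^+ n.+1) + 2^-1 ^+ n.+1 by rewrite /Mm halfS; field.
apply: (step n.+1 m1n Y1 Y2 x y z) => //; [lra|by have := Mm0 n; have := half_ge0 n.+1; lra|].
by move=> t ct tz; apply: near_x => //; lra.
Qed.

End AnconaInequality.

(** * Orbit geometry and the exponential lower bound *)

Section GeometricOrbit.
Context {R : realType} {G : groupType} {X : metricType R}.
Variables (act : G -> X -> X) (o : X).
Hypothesis X_proper : proper_space X.
Hypothesis act_geometric : geometric_action act.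

Lemma orbit_mdist (x y : G) : mdist (act x o) (act y o) = mdist o (act (x^-1 * y)%g o).
Proof.
case: act_geometric => -[act1 actM] iso _ _.
by rewrite -(iso x o) -actM mulVKg.
Qed.

Lemma orbit_coarsely_dense : exists2 r : R, 0 <= r &
  forall w, exists g, mdist w (act g o) <= r.
Proof.
case: act_geometric => -[act1 actM] iso _ [K Kc KX].
have K0 : K !=set0.
  have : (\bigcup_(g in [set: G]) (act g @` K)) o by rewrite KX.
  by case=> g _ [k Kk _]; exists k.
have [k kK kmax] := compact_EVT_max K0 Kc
  (continuous_subspaceT (@mdist_continuous R X o)).
exists (mdist o k); first exact: mdist_ge0.
move=> w; have : (\bigcup_(g in [set: G]) (act g @` K)) w by rewrite KX.
case=> g _ [k' Kk' <-]; exists g; rewrite iso metric_sym.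
by apply: kmax; rewrite inE.
Qed.

Lemma orbit_ball_finite (r : R) : 0 <= r ->
  finite_set [set g | mdist o (act g o) <= r].
Proof.
move=> r0; case: act_geometric => _ _ act_proper _.
have := act_proper _ (@X_proper o r); apply: sub_finite_set => g /= gr.
exists (act g o); split => //; exists o => //=.
by rewrite mdistxx.
Qed.

End GeometricOrbit.

Lemma finite_positive_lower_bound (R : realFieldType) (T : choiceType) (B : set T)
    (f : T -> R) : finite_set B -> (forall b, B b -> 0 < f b) ->
  exists2 e : R, 0 < e & forall b, B b -> e <= f b.
Proof.
move=> /finite_seqP[r ->] f0.
have {}f0 b : b \in r -> 0 < f b by exact: f0.
suff [e e0 ef] : exists2 e : R, 0 < e & forall b, b \in r -> e <= f b by exists e.
elim: r f0 => [|b r IHr] f0; first by exists 1.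
have [|e e0 ef] := IHr; first by move=> b' b'r; apply: f0; rewrite inE b'r orbT.
exists (Num.min (f b) e); first by rewrite lt_min e0 f0// mem_head.
move=> b'; rewrite inE => /orP[/eqP ->|/ef b'e]; first by rewrite ge_min lexx.
by rewrite ge_min b'e orbT.
Qed.

Section GreenLowerBound.
Context {R : realType} {G : groupType} {X : metricType R}.
Variables (act : G -> X -> X) (o : X) (mu : G -> R) (S : seq G) (C rho : R).
Hypothesis X_proper : proper_space X.
Hypothesis X_geodesic : geodesic_space X.
Hypothesis act_geometric : geometric_action act.
Hypothesis muS : step_distribution mu S.
Hypothesis mu_irr : irreducible mu.
Hypothesis rho01 : 0 <= rho < 1.
Hypothesis decay : forall n x y, transition mu n x y <= C * rho ^+ n.

Local Notation Gr := (potential (transition mu) 1).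

Lemma potential_translate x y : Gr x y = Gr 1%g (x^-1 * y)%g.
Proof.
rewrite /potential; congr (limn _); apply/funext => N.
by apply: eq_bigr => n _; rewrite /transition invg1 mul1g.
Qed.

Lemma potential_gt0 x y : 0 < Gr x y.
Proof.
have [n xy] := mu_irr x y.
apply: lt_le_trans (partial_le_potential1 (forward_walk_kernel muS) rho01 decay n.+1 x y).
rewrite /partial_potential big_nat_recr//= expr1n mul1r ltr_wpDl//.
apply: sumr_ge0 => i _; rewrite expr1n mul1r.
exact: (walk_ge0 (forward_walk_kernel muS)).
Qed.

(** A Harnack chain: orbit points shadowing a geodesic at unit spacing are pairwise consecutively 2
    r + 1 close, so by translation and finiteness of orbit balls each link has Green function at
    least [e]; links multiply up to the bound [B] on G(z, z). The exponent counts [m] links and one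
    at each end. *)
Lemma potential_exp_lower_bound : exists2 c : R, 0 < c <= 1 &
  forall x y (m : nat), mdist (act x o) (act y o) <= m%:R -> c ^+ m.+2 <= Gr x y.
Proof.
have [r r0 dense] := orbit_coarsely_dense o act_geometric.
have r1 : 0 <= 2 * r + 1 by lra.
have [e e0 eP] := @finite_positive_lower_bound R G _ (Gr 1%g)
  (orbit_ball_finite o X_proper act_geometric r1) (fun b _ => potential_gt0 1%g b).
have near x y : mdist (act x o) (act y o) <= 2 * r + 1 -> e <= Gr x y.
  by rewrite (orbit_mdist o act_geometric) potential_translate => /eP.
pose B := C / (1 - rho); have GB x y : Gr x y <= B.
  exact: (potential1_bounded (forward_walk_kernel muS) rho01 decay).
have B0 : 0 < B by apply: lt_le_trans (GB 1%g 1%g); exact: potential_gt0.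
clearbody B.
(* The bound by [e] serves the first link, and the bound by e / B every later one. *)
pose c := Num.min (Num.min e (e / B)) 1.
have ce : c <= e by rewrite !ge_min lexx.
have ceB : c <= e / B by rewrite !ge_min lexx orbT.
have c1 : c <= 1 by rewrite ge_min lexx orbT.
have c0 : 0 < c by rewrite !lt_min e0 divr_gt0 ?ltr01.
exists c; first by rewrite c0 c1.
have chain x z y n : c ^+ n.+1 <= Gr x z ->
    mdist (act z o) (act y o) <= 2 * r + 1 -> c ^+ n.+2 <= Gr x y.
  move=> xz /near zy.
  have : Gr x z * Gr z y <= B * Gr x y.
    apply: le_trans (potential1_mul_le (forward_walk_kernel muS) rho01 decay x z y) _.
    by rewrite ler_wpM2r// ltW// potential_gt0.
  rewrite -ler_pdivrMl// => h; apply: le_trans h.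
  rewrite exprSr -(ler_pM2l B0) mulVKf ?gt_eqF// mulrCA.
  apply: ler_pM => //; rewrite ?mulr_ge0 ?exprn_ge0 ?(ltW c0) ?(ltW B0)//.
  by apply: le_trans zy; rewrite mulrC -ler_pdivlMr.
move=> x y m xy.
have [g [g0 gl gE]] := geodesic_unit_speed (act x o) (act y o) X_geodesic.
set l := mdist _ _ in xy gl gE; have l0 : 0 <= l := mdist_ge0 _ _.
have [h hP] := choice dense.
pose T (i : nat) : R := Num.min i%:R l.
have T0l i : 0 <= T i <= l by rewrite /T le_min ler0n l0/= ge_min lexx orbT.
have Tm : T m = l by rewrite /T min_r.
apply: (@chain x (h (g (T m))) y m); last first.
  by rewrite Tm gl metric_sym; apply: le_trans (hP _) _; lra.
elim: m {xy Tm} => [|m IHm].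
  rewrite expr1; apply: le_trans ce _; apply: near.
  have -> : act x o = g (T 0%N) by rewrite /T min_l.
  by apply: le_trans (hP _) _; lra.
apply: chain IHm _.
have TS : 0 <= T m <= T m.+1.
  by case/andP: (T0l m) => -> _ /=; rewrite /T le_min !ge_min lexx orbT andbT ler_nat leqnSn.
have TS1 : T m.+1 <= T m + 1.
  rewrite /T -(@natr1 _ m); case: (leP (m%:R + 1) l) => ?; case: (leP m%:R l) => ?; lra.
have gg : mdist (g (T m)) (g (T m.+1)) <= 1.
  by case/andP: (T0l m.+1) => _ ?; rewrite gE//; lra.
have := hP (g (T m)); have := hP (g (T m.+1)).
have := metric_triangle (act (h (g (T m))) o) (g (T m)) (act (h (g (T m.+1))) o).
have := metric_triangle (g (T m)) (g (T m.+1)) (act (h (g (T m.+1))) o).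
by rewrite (metric_sym (act _ o) (g (T m))); lra.
Qed.

End GreenLowerBound.

Theorem theorem1p10 (R : realType) (G : groupType) (X : metricType R)
    (act : G -> X -> X) (o : X) (mu : G -> R)
    (G_fg : finitely_generated G) (G_nonamenable : ~ amenable G R)
    (X_proper : proper_space X) (X_geodesic : geodesic_space X)
    (act_geometric : geometric_action act)
    (mu_prob : finitely_supported_probability mu)
    (mu_irr : irreducible mu) :
  forall (k s : R) (kappa : R -> R),
    0 <= k -> 0 <= s -> morse_gauge kappa ->
  exists2 C : R, 0 < C &
    forall (Y1 Y2 : set X) (x y z : G),
      closed (Y1 `|` Y2) ->
      morse kappa (Y1 `|` Y2) ->
      narrow s Y1 Y2 (act z o) ->
      antipodal k Y1 Y2 (act z o) (act x o) (act y o) ->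
    ((C^-1)%:E * (green mu x z * green mu z y) <= green mu x y)%E /\
    (green mu x y <= C%:E * (green mu x z * green mu z y))%E.
Proof.
move=> k s kappa k0 s0 gauge.
have [S muS] := step_distribution_exists mu_prob.
have [C [rho rho01 decay]] := transition_decay muS mu_irr G_nonamenable.
have fwd := forward_walk_kernel muS.
have [c c01 lower] := potential_exp_lower_bound o X_proper X_geodesic
  act_geometric muS mu_irr rho01 decay.
pose D := 1 + \sum_(t <- S) mdist o (act t o).
have D0 : 0 < D by rewrite ltr_wpDr// sumr_ge0// => t _; exact: mdist_ge0.
have DS t : t \in S -> mdist o (act t o) <= D.
  move=> tS; rewrite /D (big_rem t)//= addrCA lerDl addr_ge0// sumr_ge0// => t' _.
  exact: mdist_ge0.
have stepD x t : t \in S -> mdist (act x o) (act (x * t)%g o) <= D.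
  by move=> /DS tD; rewrite (orbit_mdist o act_geometric) mulKg.
have stepD' x t : t \in S -> mdist (act x o) (act (x * t^-1)%g o) <= D.
  by move=> /DS tD; rewrite metric_sym (orbit_mdist o act_geometric) invgM invgK mulgVK.
have [K K4 coneK] := antipodal_cone X_proper X_geodesic gauge k0.
have [M M0 anc] := cone_ancona X_geodesic X_proper fwd (backward_walk_kernel muS)
  rho01 decay c01 lower D0 stepD stepD' gauge s0 K4.
pose B := C / (1 - rho).
have GB x y : potential (transition mu) 1 x y <= B.
  exact: (potential1_bounded fwd rho01 decay).
have G0 x y : 0 < potential (transition mu) 1 x y.
  exact: (potential_gt0 muS mu_irr rho01 decay).
have B0 : 0 < B by apply: lt_le_trans (GB 1%g 1%g).
(* [B] bounds G(z, z) in the supermultiplicative lower bound, and [M] is the constant of the upper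
   bound. *)
exists (M + B); first by rewrite ltr_wpDl.
move=> Y1 Y2 x y z Yc Ym nY [xY1 yY2 xk yk].
rewrite !(green_potential muS rho01 decay) -!EFinM !lee_fin; split.
  rewrite ler_pdivrMl ?ltr_wpDl//.
  apply: le_trans (potential1_mul_le fwd rho01 decay x z y) _.
  rewrite ler_wpM2r ?(ltW (G0 _ _))//; apply: le_trans (GB z z) _.
  by rewrite lerDr.
apply: (@le_trans _ _ (M * (potential (transition mu) 1 x z *
    potential (transition mu) 1 z y))).
  by apply: (anc Y1 Y2) => //; exact: coneK.
by rewrite ler_wpM2r ?lerDl ?(ltW B0)// mulr_ge0 ?(ltW (G0 _ _)).
Qed.
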